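(* Let $F$ be a Pythagorean formally real field with finitely many orderings such that $X_F$ is connected and $\operatorname{rank}X_F\neq1$. Then there exists $\tau\in\mathrm{Gal}(F^{(3)}/F(\sqrt{-1}))$ with $\chi_\tau\neq1$ (i.e. $\tau\notin\Phi_F$) such that $\chi_\tau X_F=X_F$.
   Context: $F$ has characteristic $0$; Pythagorean: every sum of two squares is a square; formally real: $-1$ is not a sum of squares. $F^{(2)}=F(\sqrt a:a\in\dot F)$, $F^{(3)}$ the compositum of all quadratic extensions $K$ of $F^{(2)}$ with $K/F$ Galois; $\mathcal G_F=\mathrm{Gal}(F^{(3)}/F)$ with Frattini subgroup $\Phi_F=\mathrm{Gal}(F^{(3)}/F^{(2)})$. $X_F$ is the set of orderings, each identified with its signature character in $\chi(\dot F/\dot F^2)$. For $\tau\in\mathcal G_F$, $\chi_\tau(a)=\tau(\sqrt a)/\sqrt a$. Two orderings $\sigma,\sigma'$ are simply connected if there are orderings $\rho,\rho'$ with $\sigma\sigma'=\rho\rho'$ (product of characters) and $\{\sigma,\sigma'\}\neq\{\rho,\rho'\}$; connectedness is the equivalence relation generated by this; $X_F$ is connected if it has one equivalence class. $\operatorname{rank}X_F$ is the $\mathbb F_2$-dimension of the subgroup of $\chi(\dot F/\dot F^2)$ generated by $X_F$. *)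

(* Defs.v *)
From HB Require Import structures.
From mathcomp Require Import all_boot all_order all_algebra all_fingroup all_solvable all_field.
From Stdlib Require Import Relations.
From Stdlib Require List.
Set Implicit Arguments. Unset Strict Implicit. Unset Printing Implicit Defensive.
Import GRing.Theory.
Local Open Scope ring_scope.

Definition char0 (F : fieldType) : Prop := [pchar F] =i pred0.

Definition pythagorean (F : fieldType) : Prop :=
  forall a b : F, exists c : F, a ^+ 2 + b ^+ 2 = c ^+ 2.

Definition formally_real (F : fieldType) : Prop :=
  forall s : seq F, \sum_(x <- s) x ^+ 2 <> -1.

Definition ordering (F : fieldType) (P : F -> Prop) : Prop :=
  [/\ forall x y, P x -> P y -> P (x + y),
      forall x y, P x -> P y -> P (x * y),
      forall x, P x \/ P (- x) & ~ P (-1)].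

Definition finitely_many_orderings (F : fieldType) : Prop :=
  exists s : seq (F -> Prop), forall P, ordering P ->
    exists2 Q, List.In Q s & forall x, P x <-> Q x.

(* A character f is encoded by the proposition "f a = -1".  Characters are
   compared on F^* only. *)
Definition chr (F : fieldType) := F -> Prop.
Definition chr_eq (F : fieldType) (f g : chr F) : Prop :=
  forall a : F, a != 0 -> (f a <-> g a).
Definition chr_one (F : fieldType) : chr F := fun _ => False.
Definition chr_mul (F : fieldType) (f g : chr F) : chr F :=
  fun a => ~ (f a <-> g a).

Definition sgn (F : fieldType) (P : F -> Prop) : chr F := fun a => ~ P a.

Definition XF (F : fieldType) (f : chr F) : Prop :=
  exists2 P, ordering P & chr_eq f (sgn P).

Definition same_pair (F : fieldType) (s s' r r' : chr F) : Prop :=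
  (chr_eq s r /\ chr_eq s' r') \/ (chr_eq s r' /\ chr_eq s' r).

Definition simply_connected (F : fieldType) (s s' : chr F) : Prop :=
  XF s /\ XF s' /\
  exists r r', [/\ XF r, XF r', chr_eq (chr_mul s s') (chr_mul r r')
                 & ~ same_pair s s' r r'].

(* equivalence relation generated by simple connectedness (orderings being
   identified with their characters) *)
Definition conn_step (F : fieldType) (s t : chr F) : Prop :=
  chr_eq s t \/ simply_connected s t.

Definition XF_connected (F : fieldType) : Prop :=
  forall s t : chr F, XF s -> XF t -> clos_refl_sym_trans _ (@conn_step F) s t.

Definition chr_prod (F : fieldType) (s : seq (chr F)) : chr F :=
  foldr (@chr_mul F) (@chr_one F) s.

Definition in_span (F : fieldType) (X : chr F -> Prop) (f : chr F) : Prop :=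
  exists s : seq (chr F), (forall g, List.In g s -> X g) /\ chr_eq f (chr_prod s).

Definition lin_indep (F : fieldType) (b : seq (chr F)) : Prop :=
  forall m : bitseq, size m = size b ->
    chr_eq (chr_prod (mask m b)) (@chr_one F) -> forall i, nth false m i = false.

Definition rank_is (F : fieldType) (X : chr F -> Prop) (n : nat) : Prop :=
  exists b : seq (chr F), [/\ size b = n,
    forall g, List.In g b -> in_span X g,
    lin_indep b &
    forall f, X f -> in_span (fun g => List.In g b) f].

Section Ext.
Variables (F : fieldType) (L : splittingFieldType F).

Definition is_F2 (E2 : {subfield L}) : Prop :=
  (forall r : L, r ^+ 2 \in (1%VS : {vspace L}) -> r \in E2) /\
  (forall E : {subfield L},
     (forall r : L, r ^+ 2 \in (1%VS : {vspace L}) -> r \in E) -> (E2 <= E)%VS).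

Definition good_quad (E2 K : {subfield L}) : Prop :=
  (E2 <= K)%VS /\ \dim K = (2 * \dim E2)%N /\ galois 1%VS K.

Definition is_F3 (E2 E3 : {subfield L}) : Prop :=
  (forall K : {subfield L}, good_quad E2 K -> (K <= E3)%VS) /\
  (forall E : {subfield L},
     (forall K : {subfield L}, good_quad E2 K -> (K <= E)%VS) -> (E3 <= E)%VS).

Definition chi (E : {vspace L}) (tau : gal_of E) : chr F :=
  fun a => exists r : L, r ^+ 2 = a%:A /\ tau r = - r.
End Ext.

(* Main.v *)
(** The idea is to find a subgroup [M] of index 2 in [F^*], containing [-1], whose
    complement consists of rigid elements ([1 + a] lies in [F^2] or [a F^2]); the
    character [alpha] with kernel [M] then permutes the orderings, and it is trivial
    on [-1], so it is induced by an automorphism fixing [sqrt (-1)].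

    Let [A] be the smallest subring containing every [x] with [|x| <= 1] for some
    ordering.  It is a valuation ring convex for all orderings, and by the Pythagorean
    property every element outside [H = A^* F^2] is rigid.  So it suffices that
    [H <> F^*].  If [H = F^*], compare orderings by the topologies that they induce at
    the scale of the units of [A].  Weak approximation shows that a four-element fan
    cannot meet two classes, so connectedness leaves a single class.  With at least two
    orderings, all of them having the same topology, some unit [d] of [A] is
    infinitesimal everywhere and its radical is the maximal ideal of a smaller ring
    convex for all orderings, a contradiction.

    On the Galois side, Kummer theory realizes [alpha] on any Galois extension
    containing [F^(2)].  One also has to see that [F^(2)] is contained in [F^(3)], that
    is, that [F^(2)] is not quadratically closed: if [alpha a = -1], the fourth root
    of [a] is not in [F^(2)]. *)

Require Import Defs.
From HB Require Import structures.
From mathcomp Require Import all_boot all_order all_algebra all_fingroup all_solvable all_field.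
From Stdlib Require Import Relations.
From Stdlib Require List.
Import GRing.Theory.
Local Open Scope ring_scope.
From mathcomp Require Import ring lra.
From mathcomp Require boolp classical_sets.
Import Order.TTheory Num.Theory.

Set Implicit Arguments.
Unset Strict Implicit.

(** * Zorn's lemma, and orderings as real field structures *)

Lemma zorn_pred (T : Type) (Q : (T -> Prop) -> Prop) (A0 : T -> Prop) (x0 : T) :
  Q A0 -> A0 x0 ->
  (forall C : (T -> Prop) -> Prop, (exists B, C B) ->
     (forall B, C B -> Q B) ->
     (forall B B', C B -> C B' -> (forall x, B x -> B' x) \/ (forall x, B' x -> B x)) ->
     Q (fun x => exists2 B, C B & B x)) ->
  exists A, [/\ Q A, forall x, A0 x -> A x
    & forall B, Q B -> (forall x, A x -> B x) -> forall x, B x -> A x].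
Proof.
move=> QA0 A0x0 Qchain.
(* [R] is vacuous on the empty predicate because the empty chain must be covered too; the point [x0]
   of [A0] then keeps the maximal predicate nonempty. *)
pose R (A : T -> Prop) := (exists x, A x) -> Q A /\ forall x, A0 x -> A x.
have [|A [RA Amax]] := @classical_sets.Zorn_bigcup T R.
  move=> C CR Ctot [x [B CB Bx]].
  pose C' B' := C B' /\ exists x, B' x.
  have -> : classical_sets.bigcup C id = (fun x => exists2 B, C' B & B x).
    apply: boolp.funext => y; apply: boolp.propext; split.
      by case=> B' CB' B'y; exists B' => //; split=> //; exists y.
    by case=> B' [CB' _] B'y; exists B'.
  have BC' : C' B by split=> //; exists x.
  split.
    apply: Qchain; first by exists B.
      by move=> B' [CB' nB']; have [] := CR _ CB' nB'.
    by move=> B1 B2 [CB1 _] [CB2 _]; exact: Ctot.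
  by move=> y A0y; exists B => //; have [_] := CR B CB (ex_intro _ x Bx); apply.
have neA : exists x, A x.
  apply: boolp.contrapT => nA; apply: (Amax A0); last by move=> _; split.
  split; last by move/(_ x0 A0x0) => Ax0; apply: nA; exists x0.
  by move=> y Ay; case: nA; exists y.
have [QA sA0] := RA neA; exists A; split=> // B QB sAB x Bx.
apply: boolp.contrapT => nAx; apply: (Amax B).
  by split=> // sBA; apply: nAx; apply: sBA.
by move=> _; split=> // y A0y; apply: sAB; apply: sA0.
Qed.

Lemma ordering_sqr (F : fieldType) (P : F -> Prop) (x : F) : ordering P -> P (x ^+ 2).
Proof.
case=> _ PM Pt _; rewrite expr2; case: (Pt x) => Px; first exact: PM.
by rewrite -mulrNN; apply: PM.
Qed.

Lemma ordering_anti (F : fieldType) (P : F -> Prop) (x : F) :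
  ordering P -> P x -> P (- x) -> x = 0.
Proof.
move=> oP; have [_ PM _ PN1] := oP => Px PNx; apply/eqP; apply: contra_notT PN1 => x0.
have -> : -1 = (x * - x) * (x^-1) ^+ 2 by field.
by apply: (PM); [apply: PM | apply: ordering_sqr].
Qed.

(** The type mentions [oP], so that each ordering gets its own real field structure, found by
    inference, on the same field. *)
Definition ordered_by (F : fieldType) (P : F -> Prop) (oP : ordering P) : Type := F.

HB.instance Definition _ (F : fieldType) (P : F -> Prop) (oP : ordering P) :=
  GRing.Field.copy (ordered_by oP) F.

(** The terms [x - 0] and [0 - x] come from [x <= y] being encoded as [P (y - x)]. *)
Fact ordered_by_anti (F : fieldType) (P : F -> Prop) (oP : ordering P) (x : F) :
  boolp.asbool (P (x - 0)) -> boolp.asbool (P (0 - x)) -> x = 0.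
Proof.
by move=> /boolp.asboolP + /boolp.asboolP; rewrite subr0 sub0r; apply: ordering_anti.
Qed.

Fact ordered_by_add (F : fieldType) (P : F -> Prop) (oP : ordering P) (x y : F) :
  boolp.asbool (P (x - 0)) -> boolp.asbool (P (y - 0)) -> boolp.asbool (P (x + y - 0)).
Proof.
move=> /boolp.asboolP + /boolp.asboolP; rewrite !subr0 => Px Py.
by apply/boolp.asboolP; case: oP => PD _ _ _; apply: PD.
Qed.

Fact ordered_by_mul (F : fieldType) (P : F -> Prop) (oP : ordering P) (x y : F) :
  boolp.asbool (P (x - 0)) -> boolp.asbool (P (y - 0)) -> boolp.asbool (P (x * y - 0)).
Proof.
move=> /boolp.asboolP + /boolp.asboolP; rewrite !subr0 => Px Py.
by apply/boolp.asboolP; case: oP => _ PM _ _; apply: PM.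
Qed.

Fact ordered_by_sub (F : fieldType) (P : F -> Prop) (oP : ordering P) (x y : F) :
  boolp.asbool (P ((y - x) - 0)) = boolp.asbool (P (y - x)).
Proof. by rewrite subr0. Qed.

Fact ordered_by_total (F : fieldType) (P : F -> Prop) (oP : ordering P) (x : F) :
  boolp.asbool (P (x - 0)) || boolp.asbool (P (0 - x)).
Proof.
apply/orP; rewrite subr0 sub0r; case: oP => _ _ Pt _.
by case: (Pt x) => Px; [left|right]; apply/boolp.asboolP.
Qed.

Definition ordered_by_norm (F : fieldType) (P : F -> Prop) (x : F) : F :=
  if boolp.asbool (P (x - 0)) then x else - x.

Fact ordered_by_normN (F : fieldType) (P : F -> Prop) (oP : ordering P) (x : F) :
  ordered_by_norm P (- x) = ordered_by_norm P x.
Proof.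
rewrite /ordered_by_norm opprK !subr0.
case: (boolp.asboolP (P x)) => Px; case: (boolp.asboolP (P (- x))) => PNx //.
  by rewrite (ordering_anti oP Px PNx) oppr0.
by case: oP => _ _ Pt _; case: (Pt x).
Qed.

Fact ordered_by_ge0_norm (F : fieldType) (P : F -> Prop) (oP : ordering P) (x : F) :
  boolp.asbool (P (x - 0)) -> ordered_by_norm P x = x.
Proof. by rewrite /ordered_by_norm => ->. Qed.

HB.instance Definition _ (F : fieldType) (P : F -> Prop) (oP : ordering P) :=
  Num.IntegralDomain_isLeReal.Build (ordered_by oP)
    (ordered_by_add oP) (ordered_by_mul oP) (ordered_by_anti oP)
    (ordered_by_sub oP) (ordered_by_total oP)
    (ordered_by_normN oP) (ordered_by_ge0_norm oP) (fun x y => erefl).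

Definition lt_by (F : fieldType) (P : F -> Prop) (x y : F) : Prop := ~ P (x - y).

Lemma leP_by (F : fieldType) (P : F -> Prop) (oP : ordering P) (x y : F) :
  P (y - x) <-> ((x : ordered_by oP) <= y).
Proof. by split=> [Pxy|/boolp.asboolP//]; apply/boolp.asboolP. Qed.

Lemma geP_by (F : fieldType) (P : F -> Prop) (oP : ordering P) (x : F) :
  P x <-> ((0 : ordered_by oP) <= x).
Proof. by rewrite -{1}[x]subr0; exact: leP_by. Qed.

Lemma ltP_by (F : fieldType) (P : F -> Prop) (oP : ordering P) (x y : F) :
  lt_by P x y <-> ((x : ordered_by oP) < y).
Proof.
rewrite real_ltNge ?num_real //.
split=> [nP|/negP nle P'].
  by apply/negP => /(leP_by oP).
by apply: nle; apply/(leP_by oP).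
Qed.

(** A maximal preordering [P] is total: if [x] is not in [P], then [P + P x] is larger, so it
    contains [-1 = a + b x], whence [- x = (1 + a) b / b^2] lies in [P]. *)
Lemma preordering_extends (F : fieldType) (T : F -> Prop) :
  (forall x, T (x ^+ 2)) ->
  (forall x y, T x -> T y -> T (x + y)) -> (forall x y, T x -> T y -> T (x * y)) ->
  ~ T (-1) ->
  exists2 P, ordering P & forall x, T x -> P x.
Proof.
move=> Tsq TD TM TN1.
pose Q (A : F -> Prop) := [/\ forall x y, A x -> A y -> A (x + y),
  forall x y, A x -> A y -> A (x * y) & ~ A (-1)].
have [||C [B0 CB0] CQ Ctot|P [[PD PM PN1] sTP Pmax]] := @zorn_pred F Q T (1 ^+ 2) => //.
  split; last by case=> B CB; have [_ _] := CQ B CB.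
  - move=> x y [B CB Bx] [B' CB' B'y].
    have [sBB'|sB'B] := Ctot _ _ CB CB'.
      by exists B' => //; have [D _ _] := CQ _ CB'; apply: D => //; apply: sBB'.
    by exists B => //; have [D _ _] := CQ _ CB; apply: D => //; apply: sB'B.
  - move=> x y [B CB Bx] [B' CB' B'y].
    have [sBB'|sB'B] := Ctot _ _ CB CB'.
      by exists B' => //; have [_ D _] := CQ _ CB'; apply: D => //; apply: sBB'.
    by exists B => //; have [_ D _] := CQ _ CB; apply: D => //; apply: sB'B.
have Psq x : P (x ^+ 2) by apply: sTP.
exists P => //; split=> // x; apply: boolp.contrapT => /boolp.not_orP[nPx nPNx].
apply: nPx; pose B y := exists a b, [/\ P a, P b & y = a + b * x].
have P0 : P 0 by have := Psq 0; rewrite expr0n.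
have P1 : P 1 by have := Psq 1; rewrite expr1n.
apply: (Pmax B); first 1 last.
- by move=> y Py; exists y, 0; rewrite mul0r addr0.
- by exists 0, 1; rewrite mul1r add0r.
split.
- move=> _ _ [a [b [Pa Pb ->]]] [c [d [Pc Pd ->]]].
  by exists (a + c), (b + d); split; [exact: PD | exact: PD | ring].
- move=> _ _ [a [b [Pa Pb ->]]] [c [d [Pc Pd ->]]].
  exists (a * c + (b * d) * x ^+ 2), (a * d + b * c); split; last by ring.
    by apply: (PD); apply: (PM) => //; apply: (PM).
  by apply: (PD); apply: (PM).
move=> [a [b [Pa Pb e]]]; apply: nPNx; have b0 : b != 0.
  by apply/eqP => b0; apply: PN1; rewrite e b0 mul0r addr0.
have -> : - x = (1 + a) * b * (b^-1) ^+ 2.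
  have -> : 1 + a = - (b * x) by rewrite -[1]opprK e; ring.
  by field.
by apply: (PM); [apply: (PM) => //; apply: PD | exact: Psq].
Qed.

(** If [x] is not a square, the elements [s^2 - x t^2] form a preordering, as sums of two squares
    are squares. An ordering above it contains both [x] and [- x], so [x = 0], which is a square. *)
Lemma pythagorean_pos_sqr (F : fieldType) (x : F) :
  pythagorean F -> formally_real F ->
  (forall P, ordering P -> P x) -> exists s, x = s ^+ 2.
Proof.
move=> pyth fr Px; apply: boolp.contrapT => nsq.
pose T y := exists s t, y = s ^+ 2 - x * t ^+ 2.
have TD y z : T y -> T z -> T (y + z).
  move=> [s [t ->]] [s' [t' ->]].
  have [u eu] := pyth s s'; have [v ev] := pyth t t'.
  by exists u, v; rewrite -eu -ev; ring.
have Tsq y : T (y ^+ 2) by exists y, 0; ring.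
have TMx : T (- x) by exists 0, 1; ring.
have TM y z : T y -> T z -> T (y * z).
  move=> [s [t ->]] [s' [t' ->]].
  have [u eu] := pyth (s * s') (x * (t * t')).
  have [v ev] := pyth (s * t') (s' * t).
  exists u, v; rewrite -eu -ev; ring.
have [|P oP sTP] := preordering_extends Tsq TD TM.
  move=> [s [t e]]; have t0 : t != 0.
    apply/eqP => t0; apply: (fr [:: s]); rewrite big_seq1 e t0; ring.
  have [u eu] := pyth 1 s; apply: nsq; exists (u / t).
  rewrite expr_div_n -eu expr1n -[1]opprK e; field; exact: t0.
apply: nsq; exists 0; rewrite expr0n /=; apply: (ordering_anti oP (Px P oP)).
exact: sTP.
Qed.

Lemma formally_real_ordering (F : fieldType) :
  pythagorean F -> formally_real F -> exists P : F -> Prop, ordering P.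
Proof.
move=> pyth fr; have [] := @preordering_extends F (fun x => exists s, x = s ^+ 2).
- by move=> x; exists x.
- by move=> _ _ [s ->] [t ->]; have [u ->] := pyth s t; exists u.
- by move=> _ _ [s ->] [t ->]; exists (s * t); rewrite exprMn.
- by move=> [s e]; apply: (fr [:: s]); rewrite big_seq1.
by move=> P oP _; exists P.
Qed.

(** * The hull of the orderings, its units, and rigidity *)

(** [P (1 - x ^+ 2)] encodes [|x| <= 1]. A subring with all such [x] is convex for [P], since
    [|x| <= |b|] gives [x = (x / b) b]. *)
Definition all_convex (F : fieldType) (B : F -> Prop) : Prop :=
  [/\ B 1, forall x y, B x -> B y -> B (x - y), forall x y, B x -> B y -> B (x * y)
    & forall P x, ordering P -> P (1 - x ^+ 2) -> B x].

(** The ring [A] of the opening outline; [unit_class] below is its group [H]. *)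
Definition hull (F : fieldType) (x : F) : Prop := forall B, all_convex B -> B x.

Definition hull_unit (F : fieldType) (u : F) : Prop := [/\ u != 0, hull u & hull u^-1].

Definition unit_class (F : fieldType) (x : F) : Prop :=
  exists u s : F, [/\ hull_unit u, s != 0 & x = u * s ^+ 2].

Lemma hull_all_convex (F : fieldType) : all_convex (@hull F).
Proof.
split=> [B [] //|x y hx hy B cB|x y hx hy B cB|P x oP Px B cB].
- by have [_ BB _ _] := cB; apply: BB; [apply: hx | apply: hy].
- by have [_ _ BM _] := cB; apply: BM; [apply: hx | apply: hy].
- by have [_ _ _ BC] := cB; apply: (BC P).
Qed.

Lemma hull1 (F : fieldType) : hull (1 : F).
Proof. by case: (hull_all_convex F). Qed.

Lemma hullB (F : fieldType) (x y : F) : hull x -> hull y -> hull (x - y).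
Proof. by case: (hull_all_convex F) => _ B _ _; apply: B. Qed.

Lemma hullM (F : fieldType) (x y : F) : hull x -> hull y -> hull (x * y).
Proof. by case: (hull_all_convex F) => _ _ M _; apply: M. Qed.

Lemma hullD (F : fieldType) (x y : F) : hull x -> hull y -> hull (x + y).
Proof.
move=> hx hy; have h0 : hull (0 : F) by rewrite -(subrr 1); apply: hullB; apply: hull1.
by rewrite -[y]opprK -(sub0r y); apply: hullB => //; apply: hullB.
Qed.

Lemma hull_le1 (F : fieldType) (P : F -> Prop) (x : F) :
  ordering P -> P (1 - x ^+ 2) -> hull x.
Proof. by case: (hull_all_convex F) => _ _ _; apply. Qed.

Lemma hull_unit1 (F : fieldType) : hull_unit (1 : F).
Proof. by split; rewrite ?oner_neq0 ?invr1; [|exact: hull1..]. Qed.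

Lemma hull_unitM (F : fieldType) (x y : F) : hull_unit x -> hull_unit y -> hull_unit (x * y).
Proof.
move=> [x0 hx hx'] [y0 hy hy']; split; rewrite ?mulf_neq0 ?invfM //; exact: hullM.
Qed.

Lemma hull_unitV (F : fieldType) (x : F) : hull_unit x -> hull_unit x^-1.
Proof. by case=> x0 hx hx'; split; rewrite ?invr_eq0 ?invrK. Qed.

Lemma hull_unitN (F : fieldType) (x : F) : hull_unit x -> hull_unit (- x).
Proof.
have hN (y : F) : hull y -> hull (- y).
  move=> hy; have h0 : hull (0 : F) by rewrite -(subrr 1); apply: hullB; apply: hull1.
  by rewrite -sub0r; exact: hullB h0 hy.
by case=> x0 hx hx'; split; rewrite ?oppr_eq0 ?invrN //; apply: hN.
Qed.

Lemma hull_unit_nat (F : fieldType) (P : F -> Prop) (n : nat) :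
  ordering P -> hull_unit (n.+1%:R : F).
Proof.
move=> oP; have hn m : hull (m.+1%:R : F).
  by elim: m => [|m IH]; [exact: hull1 | rewrite -addn1 natrD; apply: hullD => //; exact: hull1].
split=> //; first exact: negbT (@pnatr_eq0 (ordered_by oP) n.+1).
apply: (hull_le1 oP); apply/(leP_by oP).
have n0 : (0 : ordered_by oP) < n.+1%:R by rewrite ltr0n.
apply: (@exprn_ile1 (ordered_by oP)).
  by rewrite invr_ge0 ltW.
by rewrite invf_le1 // ler1n.
Qed.

Lemma hull_unit_1sqr (F : fieldType) (P : F -> Prop) (w : F) :
  ordering P -> hull w -> hull_unit (1 + w ^+ 2).
Proof.
move=> oP hw; have H (R : realFieldType) (v : R) : 1 <= 1 + v ^+ 2 by nra.
split.
- apply/eqP => e; have := H (ordered_by oP) w.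
  by rewrite [X in _ <= X](e : _ = 0 :> ordered_by oP) ler10.
- by apply: hullD; [exact: hull1 | apply: hullM].
apply: (hull_le1 oP); apply/(leP_by oP).
have h := H (ordered_by oP) w.
have n0 : (0 : ordered_by oP) < 1 + w ^+ 2 by apply: lt_le_trans h.
apply: (@exprn_ile1 (ordered_by oP)).
  by rewrite invr_ge0 ltW.
by rewrite invf_le1.
Qed.

Lemma unit_classM (F : fieldType) (x y : F) : unit_class x -> unit_class y -> unit_class (x * y).
Proof.
move=> [u [s [hu s0 ->]]] [v [t [hv t0 ->]]]; exists (u * v), (s * t).
by split; [exact: hull_unitM | rewrite mulf_neq0 | ring].
Qed.

Lemma unit_class_sqr (F : fieldType) (s : F) : s != 0 -> unit_class (s ^+ 2).
Proof. by move=> s0; exists 1, s; split; [exact: hull_unit1| |rewrite mul1r]. Qed.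

(** An element [b] of the hull outside [H] satisfies [|b| < 1] in every ordering, since otherwise
    [b^-1] would be in the hull too. So [1 + b] is positive everywhere, hence a square. *)
Lemma not_unit_class_rigid (F : fieldType) (a : F) :
  pythagorean F -> formally_real F -> a != 0 -> ~ unit_class a ->
  exists s, 1 + a = s ^+ 2 \/ 1 + a = a * s ^+ 2.
Proof.
move=> pyth fr; have [P0 oP0] := formally_real_ordering pyth fr.
have key (b : F) : b != 0 -> ~ unit_class b -> hull b -> exists s, 1 + b = s ^+ 2.
  move=> b0 nHb hb; apply: pythagorean_pos_sqr => // P oP.
  have lt1 : lt_by P (b ^+ 2) 1.
    have [//|/boolp.contrapT /(leP_by oP) ge1] := boolp.pselect (lt_by P (b ^+ 2) 1).
    case: nHb; exists b, 1; split; rewrite ?oner_neq0 ?expr1n ?mulr1 //; split=> //.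
    apply: (hull_le1 oP); apply/(leP_by oP); rewrite exprVn.
    by rewrite (@invf_le1 (ordered_by oP)) ?(lt_le_trans _ ge1) ?ltr01.
  apply/(geP_by oP); move/(ltP_by oP): lt1.
  have H (R : realFieldType) (x : R) : x ^+ 2 < 1 -> 0 <= 1 + x by nra.
  exact: H.
move=> a0 nHa.
(* Either [a] or [a^-1] is at most 1 in absolute value under [P0]; in the second case
   [1 + a = a (1 + a^-1)]. *)
have [_ _ Pt _] := oP0; case: (Pt (1 - a ^+ 2)) => Pa.
  by have [s ->] := key a a0 nHa (hull_le1 oP0 Pa); exists s; left.
have ha : hull a^-1.
  apply: (hull_le1 oP0); apply/(leP_by oP0); rewrite exprVn.
  have ge1 : (1 : ordered_by oP0) <= a ^+ 2.
    by apply/(leP_by oP0); move: Pa; rewrite opprB.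
  by rewrite (@invf_le1 (ordered_by oP0)) ?(lt_le_trans _ ge1) ?ltr01.
have [] := key a^-1 _ _ ha; first by rewrite invr_eq0.
  move=> Ha; apply: nHa; have -> : a = a^-1 * a ^+ 2 by field.
  by apply: unit_classM => //; apply: unit_class_sqr.
by move=> s e; exists s; right; rewrite -e mulrDr mulr1 divff // addrC.
Qed.

(** * Subgroups of index 2 and translation of orderings *)

(** Take [M] maximal among the multiplicative sets containing [H] and missing [a]. For [x] outside
    [M], the union of [M] and [M x] must contain [a]; so all elements outside [M] share one coset,
    and the product of two of them is in [M] because squares are. *)
Lemma maximal_subgroup (F : fieldType) (H : F -> Prop) (a : F) :
  (forall x, H x -> x != 0) -> (forall x y, H x -> H y -> H (x * y)) ->
  (forall s, s != 0 -> H (s ^+ 2)) -> a != 0 -> ~ H a ->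
  exists M : F -> Prop, [/\ forall x, H x -> M x, ~ M a, forall x, M x -> x != 0,
    forall x y, M x -> M y -> M (x * y)
    & forall x y, x != 0 -> y != 0 -> ~ M x -> ~ M y -> M (x * y)].
Proof.
move=> Hn0 HM Hsq a0 nHa.
pose Q (A : F -> Prop) := [/\ forall x, A x -> x != 0,
  forall x y, A x -> A y -> A (x * y) & ~ A a].
have H1 : H 1 by have := Hsq 1 (oner_neq0 F); rewrite expr1n.
have [||C [B0 CB0] CQ Ctot|M [[Mn0 MM nMa] sHM Mmax]] := @zorn_pred F Q H 1 => //.
  split; last by case=> B CB; have [_ _] := CQ B CB.
  - by move=> x [B CB Bx]; have [n0 _ _] := CQ _ CB; apply: n0.
  - move=> x y [B CB Bx] [B' CB' B'y].
    have [sBB'|sB'B] := Ctot _ _ CB CB'.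
      by exists B' => //; have [_ D _] := CQ _ CB'; apply: D => //; apply: sBB'.
    by exists B => //; have [_ D _] := CQ _ CB; apply: D => //; apply: sB'B.
have Msq s : s != 0 -> M (s ^+ 2) by move=> s0; apply: sHM; apply: Hsq.
exists M; split=> //.
have key x : x != 0 -> ~ M x -> exists2 m, M m & a = m * x.
  move=> x0 nMx; apply: boolp.contrapT => nm; apply: nMx.
  apply: (Mmax (fun y => M y \/ exists2 m, M m & y = m * x)); first 1 last.
  - by move=> y; left.
  - by right; exists 1; rewrite ?mul1r //; apply: sHM.
  split; last by case.
  - by move=> y [/Mn0//|[m /Mn0 m0 ->]]; rewrite mulf_neq0.
  - move=> y z [My|[m Mm ->]] [Mz|[n Mn ->]].
    + by left; apply: (MM).
    + by right; exists (y * n); [apply: (MM) | ring].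
    + by right; exists (m * z); [apply: (MM) | ring].
    + left; have -> : m * x * (n * x) = (m * n) * x ^+ 2 by ring.
      by apply: (MM); [apply: (MM) | apply: Msq].
move=> x y x0 y0 /(key x x0)[m Mm e] /(key y y0)[n Mn e'].
have m0 := Mn0 _ Mm; have n0 := Mn0 _ Mn.
have -> : x * y = (m * n) * (a / (m * n)) ^+ 2.
  by rewrite {1}expr_div_n {1}expr2 {1}e e'; field; rewrite m0 n0.
by apply: (MM); [apply: (MM) | apply: Msq; rewrite mulf_neq0 ?invr_eq0 ?mulf_neq0].
Qed.

(* The associated character is [fun a => ~ M a]; the trivial one is allowed. *)
Record index2 (F : fieldType) (M : F -> Prop) : Prop := Index2 {
  index2_neq0 : forall x, M x -> x != 0;
  index2M : forall x y, M x -> M y -> M (x * y);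
  index2_sqr : forall s, s != 0 -> M (s ^+ 2);
  index2_N1 : M (-1);
  index2MN : forall x y, x != 0 -> y != 0 -> ~ M x -> ~ M y -> M (x * y) }.

Lemma index2_mulP (F : fieldType) (M : F -> Prop) (x y : F) :
  index2 M -> x != 0 -> y != 0 -> M (x * y) <-> (M x <-> M y).
Proof.
move=> iM x0 y0; split=> [Mxy|[xy yx]]; last first.
  have [Mx|nMx] := boolp.pselect (M x); first exact: index2M (xy Mx).
  by apply: index2MN => // /yx.
split=> [Mx|My].
  have -> : y = (x * y) * x * (x^-1) ^+ 2 by field.
  by apply: (index2M iM); [exact: index2M | apply: index2_sqr; rewrite ?invr_eq0].
have -> : x = (x * y) * y * (y^-1) ^+ 2 by field.
by apply: (index2M iM); [exact: index2M | apply: index2_sqr; rewrite ?invr_eq0].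
Qed.

Lemma index2N (F : fieldType) (M : F -> Prop) (x : F) :
  index2 M -> x != 0 -> M (- x) <-> M x.
Proof.
move=> iM x0; rewrite -mulN1r index2_mulP ?oppr_eq0 ?oner_neq0 //.
by split=> [[h _]|Mx]; [apply: h; exact: index2_N1 | split=> // _; exact: index2_N1].
Qed.

(** Signs are propositions and their product is [<->]; this rule and the next transport equality of
    signs through products and quotients. *)
Lemma iff_iff (A B C A' B' C' : Prop) : (A <-> (B <-> C)) -> (A' <-> (B' <-> C')) ->
  (B <-> B') -> (C <-> C') -> (A <-> A').
Proof. by move=> -> -> -> ->. Qed.

Lemma iff_cancel (A B C A' B' C' : Prop) : (A <-> (B <-> C)) -> (A' <-> (B' <-> C')) ->
  (A <-> A') -> (B <-> B') -> (C <-> C').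
Proof.
move=> hA hA' hAA' hBB'; have [b|nb] := boolp.pselect B.
  by move: hA hA' hAA' hBB'; tauto.
have [c|nc] := boolp.pselect C; have [c'|nc'] := boolp.pselect C'; tauto.
Qed.

(* As [x + y = x * (1 + y / x)], closure under addition amounts to: if [a] has the same
   sign under [P] and [M], so has [1 + a].  For [a] outside [M] this is rigidity.  For
   [a] in [M], if [b = 1 + a] were outside [M], then [- b] would be rigid and
   [- a = 1 - b] a square or in [- b F^2]. *)
Lemma rigid_translate (F : fieldType) (M P : F -> Prop) :
  index2 M ->
  (forall a, a != 0 -> ~ M a -> exists s, 1 + a = s ^+ 2 \/ 1 + a = a * s ^+ 2) ->
  ordering P -> ordering (fun x => x = 0 \/ (x != 0 /\ (P x <-> M x))).
Proof.
move=> iM rig oP; have [PD PM Pt PN1] := oP.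
have Psq := fun x => ordering_sqr x oP.
have PMsqr x s : s != 0 -> P (x * s ^+ 2) <-> P x.
  move=> s0; split=> h; last by apply: PM.
  by have -> : x = (x * s ^+ 2) * (s^-1) ^+ 2; [field | apply: PM].
have MMsqr x s : x != 0 -> s != 0 -> M (x * s ^+ 2) <-> M x.
  move=> x0 s0; rewrite index2_mulP ?expf_neq0 //; have := index2_sqr iM s0.
  by move: (M (s ^+ 2)) (M x) => A B; tauto.
have PN x : x != 0 -> P (- x) <-> ~ P x.
  move=> x0; split=> [PNx Px|nPx]; last by case: (Pt x).
  by move/eqP: x0; apply; exact: ordering_anti oP Px PNx.
have Pmul x y : x != 0 -> y != 0 -> P (x * y) <-> (P x <-> P y).
  move=> x0 y0; have [Px|nPx] := boolp.pselect (P x).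
    have [Py|nPy] := boolp.pselect (P y); first by split=> // _; apply: PM.
    split; last by tauto.
    move=> h; case: nPy; have -> : y = (x * y) * x * (x^-1) ^+ 2 by field.
    by apply: (PM) => //; apply: (PM).
  have [Py|nPy] := boolp.pselect (P y).
    split; last by tauto.
    move=> h; case: nPx; have -> : x = (x * y) * y * (y^-1) ^+ 2 by field.
    by apply: (PM) => //; apply: (PM).
  split; first by tauto.
  by move=> _; rewrite -mulrNN; apply: PM; apply/PN.
have key a : a != 0 -> 1 + a != 0 -> (P a <-> M a) -> P (1 + a) <-> M (1 + a).
  move=> a0 a1 e; have P1 : P 1 by have := Psq 1; rewrite expr1n.
  have M1 : M 1 by have := index2_sqr iM (oner_neq0 F); rewrite expr1n.
  have [Ma|nMa] := boolp.pselect (M a); last first.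
    have [s [es|es]] := rig a a0 nMa.
      have s0 : s != 0 by apply: contraNneq a1 => s0; rewrite es s0 expr0n.
      by rewrite es -[s ^+ 2]mul1r PMsqr // MMsqr ?oner_neq0 //; split.
    have s0 : s != 0 by apply: contraNneq a1 => s0; rewrite es s0 expr0n mulr0.
    by rewrite es PMsqr // MMsqr.
  have Pa := e.2 Ma; split=> [_|_]; last by apply: PD.
  apply: boolp.contrapT => nMb.
  have nb0 : - (1 + a) != 0 by rewrite oppr_eq0.
  have nMNb : ~ M (- (1 + a)) by rewrite index2N.
  have [s] := rig _ nb0 nMNb.
  have -> : 1 + - (1 + a) = - a by ring.
  case=> es.
    by move/eqP: a0; apply; apply: (ordering_anti oP Pa); rewrite es.
  have s0 : s != 0.
    by apply: contraNneq a0 => s0; rewrite -oppr_eq0 es s0 expr0n mulr0.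
  apply: nMb; rewrite -(MMsqr _ s) //;
  have -> : (1 + a) * s ^+ 2 = a by rewrite -[a in RHS]opprK es; ring.
  done.
split.
- move=> x y [->|[x0 ex]]; first by rewrite add0r.
  case=> [->|[y0 ey]]; first by rewrite addr0; right.
  have [->|xy0] := eqVneq (x + y) 0; first by left.
  right; split=> //; have e1 : x + y = x * (1 + y / x) by field.
  have yx0 : y / x != 0 by rewrite mulf_neq0 ?invr_eq0.
  have a0 : 1 + y / x != 0 by apply: contraNneq xy0 => h; rewrite e1 h mulr0.
  have e2 : y = x * (y / x) by field.
  have Py : P y <-> (P x <-> P (y / x)) by rewrite -Pmul // -e2.
  have My : M y <-> (M x <-> M (y / x)) by rewrite -(index2_mulP iM) // -e2.
  have ea := iff_cancel Py My ey ex.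
  rewrite {}e1; exact: iff_iff (Pmul _ _ x0 a0) (index2_mulP iM x0 a0) ex (key _ yx0 a0 ea).
- move=> x y [->|[x0 ex]]; first by rewrite mul0r; left.
  case=> [->|[y0 ey]]; first by rewrite mulr0; left.
  right; rewrite mulf_neq0 //; split=> //.
  exact: iff_iff (Pmul _ _ x0 y0) (index2_mulP iM x0 y0) ex ey.
- move=> x; have [->|x0] := eqVneq x 0; first by left; left.
  have [e|ne] := boolp.pselect (P x <-> M x); first by left; right.
  right; right; rewrite oppr_eq0; split=> //; rewrite PN // index2N //.
  have := boolp.EM (P x); have := boolp.EM (M x); tauto.
- case=> [/eqP|[_ e]]; first by rewrite oppr_eq0 oner_eq0.
  by apply: PN1; apply/e; exact: index2_N1.
Qed.

(** * Comparison of the topologies of orderings and weak approximation *)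

(* At the scale of the units of the hull, the order topology of [Q] is coarser than
   that of [P]. *)
Definition dep (F : fieldType) (P Q : F -> Prop) : Prop :=
  exists2 d, hull_unit d & forall z, lt_by P (z ^+ 2) (d ^+ 2) -> Q (1 - z ^+ 2).

(** A substitute for a minimum valid in all orderings at once: [|shrink x|] is at most [|x|] and at
    most 1, so [shrink d * shrink e] lies below both [d] and [e], and it is a unit of the hull if
    they are. *)
Definition shrink (F : fieldType) (x : F) : F := x / (1 + x ^+ 2).

Lemma shrink_unit (F : fieldType) (P : F -> Prop) (x : F) :
  ordering P -> hull_unit x -> hull_unit (shrink x).
Proof.
move=> oP hx; apply: hull_unitM => //; apply: hull_unitV.
by apply: (hull_unit_1sqr oP); case: hx.
Qed.

Lemma shrink_sqr_le (R : realFieldType) (x : R) : shrink x ^+ 2 <= x ^+ 2.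
Proof.
have h : 1 <= 1 + x ^+ 2 by nra.
rewrite /shrink expr_div_n ler_pdivrMr; last by nra.
by rewrite ler_peMr ?sqr_ge0 // exprn_ege1.
Qed.

Lemma shrink_sqr_le1 (R : realFieldType) (x : R) : shrink x ^+ 2 <= 1.
Proof.
rewrite /shrink expr_div_n ler_pdivrMr; last by nra.
by nra.
Qed.

Lemma shrinkM_le (F : fieldType) (d e : F) (P : F -> Prop) :
  ordering P -> P (d ^+ 2 - (shrink d * shrink e) ^+ 2) /\
                P (e ^+ 2 - (shrink d * shrink e) ^+ 2).
Proof.
move=> oP; split; apply/(leP_by oP); rewrite exprMn.
  apply: le_trans (_ : (shrink d ^+ 2 : ordered_by oP) <= _); last exact: shrink_sqr_le.
  apply: ler_piMr; first exact: (@sqr_ge0 (ordered_by oP)).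
  exact: (@shrink_sqr_le1 (ordered_by oP)).
apply: le_trans (_ : (shrink e ^+ 2 : ordered_by oP) <= _); last exact: shrink_sqr_le.
apply: ler_piMl; first exact: (@sqr_ge0 (ordered_by oP)).
exact: (@shrink_sqr_le1 (ordered_by oP)).
Qed.

Lemma common_small (F : fieldType) (I : Type) (l : seq I) (Phi : I -> F -> Prop)
    (P0 : F -> Prop) :
  ordering P0 ->
  (forall i d d', Phi i d -> (forall P, ordering P -> P (d ^+ 2 - d' ^+ 2)) -> Phi i d') ->
  (forall i, List.In i l -> exists2 d, hull_unit d & Phi i d) ->
  exists2 d, hull_unit d & forall i, List.In i l -> Phi i d.
Proof.
move=> oP0 mono; elim: l => [|i l IH] ex; first by exists 1 => //; exact: hull_unit1.
have [d hd Pd] := IH (fun j lj => ex j (or_intror lj)).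
have [e he Pe] := ex i (or_introl erefl).
exists (shrink d * shrink e); first by apply: hull_unitM; apply: (shrink_unit oP0).
move=> j [<-|lj]; first by apply: mono Pe _ => P oP; case: (shrinkM_le d e oP).
by apply: mono (Pd j lj) _ => P oP; case: (shrinkM_le d e oP).
Qed.

Lemma dep_scale (F : fieldType) (P Q : F -> Prop) (u : F) :
  ordering P -> ordering Q -> dep P Q -> hull_unit u ->
  exists2 d, hull_unit d & forall z, lt_by P (z ^+ 2) (d ^+ 2) -> Q (u ^+ 2 - z ^+ 2).
Proof.
move=> oP oQ [d hd dP] hu; exists (d * u); first exact: hull_unitM.
have u0 : u != 0 by case: hu.
have u2 (o : F -> Prop) (oo : ordering o) : (0 : ordered_by oo) < u ^+ 2.
  by rewrite lt0r sqrf_eq0 [X in ~~ X](negbTE u0) /= (@sqr_ge0 (ordered_by oo)).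
move=> z /(ltP_by oP) lz; have := dP (z / u); rewrite expr_div_n.
have l1 : lt_by P (z ^+ 2 / u ^+ 2) (d ^+ 2).
  apply/(ltP_by oP); rewrite (@ltr_pdivrMr (ordered_by oP)) ?u2 //.
  by rewrite exprMn in lz.
move=> /(_ l1) /(leP_by oQ) l2; apply/(leP_by oQ).
by rewrite (@ler_pdivrMr (ordered_by oQ)) ?u2 // mul1r in l2.
Qed.

(** With [x = c / (1 + c^2)] one has [s <= x^2 < - x <= - c]; the factor [n.+1] absorbs the number
    [k] of summands. *)
Lemma approx_neg (R : realFieldType) (c s : R) (k n : nat) :
  (k <= n)%N -> s <= k%:R * (c / (n.+1%:R * (1 + c ^+ 2))) ^+ 2 -> c < 0 -> c + s < 0.
Proof.
move=> kn; set w := 1 + c ^+ 2; set N : R := n.+1%:R => hs c0.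
have w1 : 1 <= w by rewrite /w; nra.
have N1 : 1 <= N by rewrite ler1n.
have kN : k%:R <= N by rewrite ler_nat leqW.
have k0 : 0 <= k%:R :> R by [].
pose x := c / w; have ex : c = x * w by rewrite /x divfK //; apply/eqP; lra.
have e : c / (N * w) = x / N by rewrite /x; field; apply/andP; split; apply/eqP; lra.
rewrite e expr_div_n in hs.
have h2 : k%:R * (x ^+ 2 / N ^+ 2) <= x ^+ 2.
  rewrite mulrA ler_pdivrMr; last by nra.
  by rewrite mulrC ler_wpM2l ?sqr_ge0 //; nra.
have h3 : x < 0 by nra.
have h4 : - x < 1.
  rewrite ltNge; apply/negP => hx; have : c <= - w by rewrite [c]ex; nra.
  by rewrite /w; nra.
have h5 : x ^+ 2 < - x by nra.
have h6 : c <= x by rewrite ex; nra.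
have h7 : s <= x ^+ 2 by exact: le_trans hs h2.
by rewrite -ltrBrDl sub0r; apply: le_lt_trans h7 _; apply: lt_le_trans h5 _; rewrite lerN2.
Qed.

Lemma approx_pos (R : realFieldType) (c s : R) : (1 + c ^+ 2) ^+ 2 < s -> 0 < c + s.
Proof. nra. Qed.

(** Take [x = c + s], where the sum of squares [s] has one term for each ordering of [l] independent
    of [P]: large there, and at most [u^2] at the orderings dependent on [P], so that the sign of
    [c] survives at the latter. *)
Lemma dep_approx (F : fieldType) (l : seq (F -> Prop)) (P : F -> Prop) (c : F) :
  ordering P -> hull_unit c -> 
  exists x, forall Q, List.In Q l -> ordering Q ->
    (dep P Q -> Q x <-> Q c) /\ (~ dep P Q -> Q x).
Proof.
move=> oP hc; pose w := 1 + c ^+ 2; pose N : F := (size l).+1%:R.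
have hw : hull_unit w by apply: (hull_unit_1sqr oP); case: hc.
have hN : hull_unit N by apply: hull_unit_nat oP.
pose u := c / (N * w).
have hu : hull_unit u by apply: hull_unitM => //; apply: hull_unitV; apply: hull_unitM.
have [|Q _|d hd dP] := @common_small F _ l
    (fun Q d => ordering Q -> dep P Q ->
       forall z, lt_by P (z ^+ 2) (d ^+ 2) -> Q (u ^+ 2 - z ^+ 2)) P oP.
- move=> Q e e' Qe ee oQ dPQ z lz; apply: Qe => //.
  move/(ltP_by oP): lz => lz; have /(leP_by oP) le := ee P oP.
  by apply/(ltP_by oP); apply: lt_le_trans lz le.
- have [[oQ dPQ]|nd] := boolp.pselect (ordering Q /\ dep P Q).
    by have [d hd dP] := dep_scale oP oQ dPQ hu; exists d.
  by exists 1; [exact: hull_unit1 | move=> oQ dPQ; case: nd].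
have [s [s0 sle sgt]] : exists s, [/\ forall Q, ordering Q -> Q s,
    forall Q, List.In Q l -> ordering Q -> dep P Q -> Q ((size l)%:R * u ^+ 2 - s)
  & forall Q, List.In Q l -> ordering Q -> ~ dep P Q -> lt_by Q (w ^+ 2) s].
  have [l' el'] : exists l', l' = l by exists l.
  (* Only the number of summands and the list of orderings to be made large vary in the induction;
     the upper bound is kept at all dependent orderings of [l]. *)
  rewrite -{2 3}el'; have sub Q : List.In Q l' -> List.In Q l by rewrite el'.
  move: l' {el'} sub; elim=> [|Q0 l' IH] sub.
    exists 0; split=> // [Q oQ|Q _ oQ _].
      by apply/(geP_by oQ).
    by rewrite mul0r subr0; apply/(geP_by oQ).
  have [s [s0 sle sgt]] := IH (fun Q lQ => sub Q (or_intror lQ)).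
  have [[oQ0 nd]|nd] := boolp.pselect (ordering Q0 /\ ~ dep P Q0); last first.
    exists s; split=> // [Q lQ oQ dQ|Q [eQ|lQ] oQ dQ]; last exact: sgt.
      have -> : (size (Q0 :: l'))%:R * u ^+ 2 - s = ((size l')%:R * u ^+ 2 - s) + u ^+ 2.
        by rewrite /= -addn1 natrD; ring.
      by have [QD _ _ _] := oQ; apply: QD; [exact: sle | exact: ordering_sqr].
    by case: nd; rewrite eQ.
  (* Otherwise the unit [d / w] would witness [dep P Q0]; the factor [w] rescales the threshold from
     1 to [w^2]. *)
  have [z [lz gz]] : exists z, lt_by P (z ^+ 2) (d ^+ 2) /\ lt_by Q0 (w ^+ 2) (z ^+ 2).
    have w0 : w != 0 by case: hw.
    have w2 (o : F -> Prop) (oo : ordering o) : (0 : ordered_by oo) < w ^+ 2.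
      by rewrite lt0r sqrf_eq0 [X in ~~ X](negbTE w0) /= (@sqr_ge0 (ordered_by oo)).
    apply: boolp.contrapT => nz; apply: nd; exists (d / w).
      by apply: hull_unitM => //; apply: hull_unitV.
    move=> z /(ltP_by oP) lz; apply: boolp.contrapT => gz; apply: nz; exists (z * w).
    split.
      apply/(ltP_by oP); rewrite exprMn -(@ltr_pdivlMr (ordered_by oP)) ?w2 //.
      by rewrite expr_div_n in lz.
    have {}gz : lt_by Q0 1 (z ^+ 2) by [].
    move/(ltP_by oQ0): gz => gz; apply/(ltP_by oQ0).
    by rewrite exprMn (@ltr_pMl (ordered_by oQ0)) ?w2.
  exists (s + z ^+ 2); split=> [Q oQ|Q lQ oQ dQ|Q [eQ|lQ] oQ dQ].
  - by have [QD _ _ _] := oQ; apply: QD; [exact: s0 | exact: ordering_sqr].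
  - have h1 := sle Q lQ oQ dQ; have h2 := dP Q lQ oQ dQ z lz.
    have -> : (size (Q0 :: l'))%:R * u ^+ 2 - (s + z ^+ 2) =
      ((size l')%:R * u ^+ 2 - s) + (u ^+ 2 - z ^+ 2) by rewrite /= -addn1 natrD; ring.
    by have [QD _ _ _] := oQ; apply: QD.
  - move/(ltP_by oQ0): gz => gz; rewrite -eQ; apply/(ltP_by oQ0).
    by apply: lt_le_trans gz _; rewrite (@lerDr (ordered_by oQ0)); apply/(geP_by oQ0); apply: s0.
  - have /(ltP_by oQ) h := sgt Q lQ oQ dQ; apply/(ltP_by oQ).
    by apply: lt_le_trans h _; rewrite (@lerDl (ordered_by oQ)); exact: (@sqr_ge0 (ordered_by oQ)).
exists (c + s) => Q lQ oQ; split=> dQ; last first.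
  have /(ltP_by oQ) h := sgt Q lQ oQ dQ.
  by apply/(geP_by oQ); apply: ltW; apply: approx_pos h.
split=> [h|Qc]; last by have [QD _ _ _] := oQ; apply: QD => //; apply: s0.
apply: boolp.contrapT => nQc.
have /(leP_by oQ) hs := sle Q lQ oQ dQ.
have c0 : (c : ordered_by oQ) < 0 by apply/(ltP_by oQ); rewrite /lt_by subr0.
have := approx_neg (leqnn _) hs c0; move/(geP_by oQ): h => h.
by rewrite ltNge h.
Qed.

(** * Four-element fans, connectedness and dependence *)

Lemma sgn_inj (F : fieldType) (P Q : F -> Prop) :
  ordering P -> ordering Q -> chr_eq (sgn P) (sgn Q) -> P = Q.
Proof.
move=> oP oQ e; apply: boolp.funext => x; apply: boolp.propext.
have [->|x0] := eqVneq x 0.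
  have P0 := ordering_sqr 0 oP; have Q0 := ordering_sqr 0 oQ.
  by rewrite expr0n in P0 Q0.
have [h1 h2] := e x x0; split=> h; apply: boolp.contrapT => n.
  by case: (h2 n).
by case: (h1 n).
Qed.

Lemma ordering_sub (F : fieldType) (P Q : F -> Prop) :
  ordering P -> ordering Q -> (forall x, P x -> Q x) -> P = Q.
Proof.
move=> oP oQ sPQ; apply: boolp.funext => x; apply: boolp.propext; split; first exact: sPQ.
move=> Qx; have [_ _ Pt _] := oP; case: (Pt x) => // PNx.
have -> : x = 0 by apply: (ordering_anti oQ Qx); exact: sPQ.
by have := ordering_sqr 0 oP; rewrite expr0n.
Qed.

Lemma ordering_N1 (F : fieldType) (P : F -> Prop) : ordering P -> ~ P (-1).
Proof. by case. Qed.

(* A four-element fan cannot meet the class of [P] and its complement: the sign of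
   [c] on the class only can be realized by a field element, for every [c]. *)
Lemma simply_connected_dep (F : fieldType) (l : seq (F -> Prop)) (P S S' : F -> Prop) :
  (forall Q, ordering Q -> List.In Q l) -> (forall x : F, x != 0 -> unit_class x) ->
  ordering P -> ordering S -> ordering S' -> simply_connected (sgn S) (sgn S') ->
  dep P S -> dep P S'.
Proof.
move=> lP all oP oS oS' [_ [_ [r [r' [[R oR er] [R' oR' er'] e npair]]]]] dS.
apply: boolp.contrapT => ndS'.
(* Every [c] is a unit of the hull times a nonzero square, so approximation of units suffices. *)
have approx c : c != 0 -> exists2 x, x != 0 & forall Q, ordering Q ->
    (dep P Q -> Q x <-> Q c) /\ (~ dep P Q -> Q x).
  move=> c0; have [u [s [hu s0 ec]]] := all c c0.
  have [x hx] := dep_approx l oP hu.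
  have cu Q : ordering Q -> Q c <-> Q u.
    move=> oQ; have [_ QM _ _] := oQ; rewrite ec; split=> h.
      have -> : u = u * s ^+ 2 * (s^-1) ^+ 2 by field.
      by apply: QM => //; apply: ordering_sqr.
    by apply: QM => //; apply: ordering_sqr.
  have [x0|x0] := eqVneq x 0; last first.
    exists x => // Q oQ; rewrite cu //; exact: hx (lP Q oQ) oQ.
  (* If [x = 0], [c] is positive on the class of [P], so [1] works. *)
  exists 1; rewrite ?oner_neq0 // => Q oQ.
  have Q1 : Q 1 by have := ordering_sqr 1 oQ; rewrite expr1n.
  split=> // dQ; rewrite cu //; split=> // _.
  apply/(hx Q (lP Q oQ) oQ).1 => //; rewrite x0.
  by have := ordering_sqr 0 oQ; rewrite expr0n.
have prod c : c != 0 -> (S c <-> S' c) <-> (R c <-> R' c).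
  move=> c0; have := e c c0; rewrite /chr_mul.
  have [h1 h2] := er c c0; have [h1' h2'] := er' c c0.
  move: h1 h2 h1' h2'; rewrite /sgn.
  have [s|s] := boolp.pselect (S c); have [s'|s'] := boolp.pselect (S' c);
  have [t|t] := boolp.pselect (R c); have [t'|t'] := boolp.pselect (R' c); tauto.
have N10 : -1 != 0 :> F by rewrite oppr_eq0 oner_neq0.
have SN := ordering_N1 oS; have SN' := ordering_N1 oS'.
have RN := ordering_N1 oR; have RN' := ordering_N1 oR'.
(* The relation [S S' = R R'] at an [x] imitating [c] on the class only: [S x] is the sign of [c]
   and [S' x] is positive. *)
have pS c x : c != 0 -> x != 0 -> (forall Q, ordering Q ->
    (dep P Q -> Q x <-> Q c) /\ (~ dep P Q -> Q x)) -> S c <-> (R x <-> R' x).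
  move=> c0 x0 hx; have := prod x x0; have := (hx S oS).1 dS; have := (hx S' oS').2 ndS'.
  by tauto.
(* If both or neither of [R], [R'] are in the class, imitating [-1] makes [-1] positive at [S]. If
   exactly one is, it equals [S], and then the two pairs coincide. *)
have [dR|ndR] := boolp.pselect (dep P R); have [dR'|ndR'] := boolp.pselect (dep P R').
- have [x x0 hx] := approx (-1) N10.
  have := pS _ _ N10 x0 hx; rewrite (hx R oR).1 // (hx R' oR').1 //; tauto.
- have eSR : S = R.
    apply: ordering_sub => // c Sc; have [->|c0] := eqVneq c 0.
      by have := ordering_sqr 0 oR; rewrite expr0n.
    have [x x0 hx] := approx c c0.
    have := pS _ _ c0 x0 hx; rewrite (hx R oR).1 //; have := (hx R' oR').2 ndR'; tauto.
  apply: npair; left; split=> c c0; first by rewrite er // eSR.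
  have := prod c c0; rewrite er' // /sgn eSR.
  have [t|t] := boolp.pselect (R c); tauto.
- have eSR : S = R'.
    apply: ordering_sub => // c Sc; have [->|c0] := eqVneq c 0.
      by have := ordering_sqr 0 oR'; rewrite expr0n.
    have [x x0 hx] := approx c c0.
    have := pS _ _ c0 x0 hx; rewrite (hx R' oR').1 //; have := (hx R oR).2 ndR; tauto.
  apply: npair; right; split=> c c0; first by rewrite er' // eSR.
  have := prod c c0; rewrite er // /sgn eSR.
  have [t|t] := boolp.pselect (R' c); tauto.
have [x x0 hx] := approx (-1) N10.
have := pS _ _ N10 x0 hx; have := (hx R oR).2 ndR; have := (hx R' oR').2 ndR'; tauto.
Qed.

(** Membership in the class of [P] is invariant under each generating step of connectedness, and [P]
    is in its own class. *)
Lemma connected_dep (F : fieldType) (l : seq (F -> Prop)) (P Q : F -> Prop) :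
  (forall Q, ordering Q -> List.In Q l) -> (forall x : F, x != 0 -> unit_class x) ->
  XF_connected F -> ordering P -> ordering Q -> dep P Q.
Proof.
move=> lP all conn oP oQ.
have XFs (S : F -> Prop) : ordering S -> XF (sgn S) by move=> oS; exists S.
have := conn _ _ (XFs P oP) (XFs Q oQ).
pose inC (f : chr F) := exists2 S, ordering S /\ dep P S & chr_eq f (sgn S).
have key f g : clos_refl_sym_trans (chr F) (@conn_step F) f g -> inC f <-> inC g.
  elim=> {f g} [f g [e|sc]|f|f g _ ->|f g h _ -> _ ->] //.
    by split=> -[S oS eS]; exists S => // a a0; [rewrite -e|rewrite e] => //; exact: eS.
  have [[S oS eS] [[S' oS' eS'] [r [r' [Xr Xr' er np]]]]] := sc.
  have scSS' : simply_connected (sgn S) (sgn S').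
    split; [exact: XFs|split; [exact: XFs|exists r, r'; split=> //]].
      move=> a a0; rewrite -er //; have := eS a a0; have := eS' a a0; rewrite /chr_mul.
      by move=> -> ->.
    case=> -[h1 h2]; apply: np; [left|right]; split=> a a0;
      by rewrite ?eS ?eS' ?h1 ?h2.
  have scS'S : simply_connected (sgn S') (sgn S).
    have [_ [_ [q [q' [Xq Xq' eq nq]]]]] := scSS'.
    split; [exact: XFs|split; [exact: XFs|exists q, q'; split=> //]].
      move=> a a0; rewrite -eq // /chr_mul; tauto.
    by case=> -[h1 h2]; apply: nq; [right|left].
  split=> -[T [oT dT] eT].
    have eST : T = S by apply: sgn_inj => // a a0; rewrite -eT // eS.
    exists S' => //; split=> //; rewrite eST in dT.
    exact: simply_connected_dep lP all oP oS oS' scSS' dT.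
  have eST : T = S' by apply: sgn_inj => // a a0; rewrite -eT // eS'.
  exists S => //; split=> //; rewrite eST in dT.
  exact: simply_connected_dep lP all oP oS' oS scS'S dT.
move/key => [h _]; have [|S [oS dS] eS] := h.
  exists P => //; split=> //; exists 1; first exact: hull_unit1.
  move=> z /(ltP_by oP) lz; apply/(leP_by oP).
  by rewrite expr1n in lz; exact: ltW lz.
by have -> : Q = S by apply: sgn_inj.
Qed.

(** * Infinitesimal units and their radicals *)

(** Here [((1 - c) / (1 + c))^2 = 1 - e] with [e = 4 c / (1 + c)^2]. Bernoulli's inequality gives
    [(1 - e)^k (1 + k e) <= 1], and [c / (1 + c^2) <= e]. *)
Lemma bernoulli_bound (R : realFieldType) (c d : R) (k : nat) :
  0 < c -> d ^+ 2 <= (((1 - c) / (1 + c)) ^+ 2) ^+ k ->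
  k%:R * (c * d ^+ 2 / (1 + c ^+ 2)) <= 1.
Proof.
move=> c0; pose e := 4 * c / (1 + c) ^+ 2.
have c1 : 1 + c != 0 by apply/eqP; lra.
have -> : ((1 - c) / (1 + c)) ^+ 2 = 1 - e by rewrite /e; field.
have e0 : 0 <= e by rewrite divr_ge0 ?sqr_ge0 //; lra.
have e1 : 0 <= 1 - e.
  have -> : 1 - e = ((1 - c) / (1 + c)) ^+ 2 by rewrite /e; field.
  exact: sqr_ge0.
have ber : (1 - e) ^+ k * (1 + k%:R * e) <= 1.
  elim: k => [|k IH]; first by rewrite expr0 mul0r addr0 mulr1.
  apply: le_trans IH; rewrite exprS -mulrA mulrC -mulrA; apply: ler_wpM2l.
    exact: exprn_ge0.
  have k0 : 0 <= k%:R :> R by [].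
  rewrite -natr1; nra.
move=> hd; have k0 : 0 <= k%:R :> R by [].
have h1 : d ^+ 2 * (1 + k%:R * e) <= 1.
  by apply: le_trans ber; apply: ler_wpM2r => //; nra.
have ce : c / (1 + c ^+ 2) <= e.
  rewrite /e ler_pdivrMr; last by nra.
  rewrite mulrAC ler_pdivlMr; last by nra.
  nra.
have -> : k%:R * (c * d ^+ 2 / (1 + c ^+ 2)) = k%:R * d ^+ 2 * (c / (1 + c ^+ 2)).
  by field; apply/eqP; nra.
apply: le_trans (_ : k%:R * d ^+ 2 * e <= _).
  by apply: ler_wpM2l => //; rewrite mulr_ge0 ?sqr_ge0.
have := sqr_ge0 d; nra.
Qed.

Lemma ratio_sqr_gt1 (R : realFieldType) (c : R) :
  c < 0 -> 1 + c != 0 -> 1 < ((1 - c) / (1 + c)) ^+ 2.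
Proof.
move=> c0 c1; have h : 0 < (1 + c) ^+ 2 by rewrite lt0r sqrf_eq0 c1 sqr_ge0.
by rewrite expr_div_n ltr_pdivlMr //; nra.
Qed.

Lemma infinitesimal_sqr (R : realFieldType) (t : R) (k : nat) :
  0 <= t -> t <= 1 -> k%:R * t <= 1 -> k%:R * t ^+ 2 <= 1.
Proof. by move=> t0 t1 kt; have k0 : 0 <= k%:R :> R by []; nra. Qed.

Definition infinitesimal (F : fieldType) (P : F -> Prop) (d : F) : Prop :=
  forall k : nat, P (1 - k%:R * d ^+ 2).

(** Choose a unit [c] positive at [P] and negative at [Q]. The powers of [(1 - c) / (1 + c)] exceed
    1 in absolute value at [Q], so by dependence they never drop below [|d|] at [P]; the Bernoulli
    bound then makes [t = c d^2 / (1 + c^2)] infinitesimal. *)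
Lemma dep_infinitesimal (F : fieldType) (P Q : F -> Prop) :
  (forall x : F, x != 0 -> unit_class x) -> ordering P -> ordering Q -> P <> Q ->
  dep P Q -> exists2 t, hull_unit t & infinitesimal P t.
Proof.
move=> all oP oQ nPQ [d hd dPQ].
have [b [Pb nQb]] : exists b, P b /\ ~ Q b.
  apply: boolp.contrapT => nb; apply: nPQ; apply: ordering_sub => // x Px.
  by apply: boolp.contrapT => nQx; apply: nb; exists x.
have b0 : b != 0.
  apply/eqP => b0; apply: nQb; rewrite b0.
  by have := ordering_sqr 0 oQ; rewrite expr0n.
have [c [s [hc s0 eb]]] := all b b0.
have [c0 _ _] := hc.
have Pc : (0 : ordered_by oP) < c.
  rewrite lt0r c0; apply/(geP_by oP); have [_ PM _ _] := oP.
  have -> : c = b * (s^-1) ^+ 2 by rewrite eb; field.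
  by apply: PM => //; apply: ordering_sqr.
have Qc : (c : ordered_by oQ) < 0.
  apply/(ltP_by oQ); rewrite /lt_by subr0 => h; apply: nQb; rewrite eb.
  by have [_ QM _ _] := oQ; apply: QM => //; apply: ordering_sqr.
pose t := c * d ^+ 2 / (1 + c ^+ 2).
have ht : hull_unit t.
  apply: hull_unitM; first by apply: hull_unitM => //; apply: hull_unitM.
  by apply: hull_unitV; apply: (hull_unit_1sqr oP); case: hc.
have le1 k : P (1 - k%:R * t).
  case: k => [|k].
    by rewrite mul0r subr0; have := ordering_sqr 1 oP; rewrite expr1n.
  apply/(leP_by oP); apply: (@bernoulli_bound (ordered_by oP)) => //.
  rewrite leNgt; apply/negP => lt.
  have lt' : lt_by P ((((1 - c) / (1 + c)) ^+ k.+1) ^+ 2) (d ^+ 2).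
    by apply/(ltP_by oP); rewrite -exprM mulnC exprM.
  have /(leP_by oQ) := dPQ _ lt'; rewrite leNgt => /negP; apply.
  rewrite -exprM mulnC exprM; apply: (@exprn_egt1 (ordered_by oQ)) => //.
  apply: (@ratio_sqr_gt1 (ordered_by oQ)) => //.
  have : (1 + c : ordered_by oP) != 0 by apply: lt0r_neq0; rewrite addr_gt0 // ltr01.
  exact.
exists t => // k; apply/(leP_by oP); apply: (@infinitesimal_sqr (ordered_by oP)).
- apply: divr_ge0; first by rewrite mulr_ge0 ?(ltW Pc) // (@sqr_ge0 (ordered_by oP)).
  by rewrite addr_ge0 ?ler01 // (@sqr_ge0 (ordered_by oP)).
- by have := le1 1%N; rewrite mul1r => /(leP_by oP).
- exact/(leP_by oP)/le1.
Qed.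

Lemma infinitesimal_lt1 (R : realFieldType) (d : R) :
  (forall k, k%:R * d ^+ 2 <= 1) -> d ^+ 2 < 1.
Proof. by move=> /(_ 2); have := sqr_ge0 d; nra. Qed.

Lemma common_scale (F : fieldType) (l : seq (F -> Prop)) (P1 P2 : F -> Prop) :
  (forall Q : F -> Prop, ordering Q -> List.In Q l) ->
  (forall x : F, x != 0 -> unit_class x) ->
  ordering P1 -> ordering P2 -> P1 <> P2 ->
  (forall P Q : F -> Prop, ordering P -> ordering Q -> dep P Q) ->
  exists d : F, [/\ hull_unit d, forall P, ordering P -> infinitesimal P d
    & forall P Q z, ordering P -> ordering Q -> lt_by P (z ^+ 2) (d ^+ 2) -> Q (1 - z ^+ 2)].
Proof.
move=> lP all oP1 oP2 nP12 deps.
(* An infinitesimal unit at [P] requires an ordering different from [P]: one of [P1], [P2] always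
   serves. *)
have inf (P : F -> Prop) : ordering P -> exists2 t, hull_unit t & infinitesimal P t.
  move=> oP; have [eP|nP] := boolp.pselect (P = P1).
    by apply: (dep_infinitesimal all oP oP2); [rewrite eP | exact: deps].
  exact: dep_infinitesimal all oP oP1 nP (deps _ _ oP oP1).
pose Phi (P Q : F -> Prop) (d : F) := ordering P -> ordering Q ->
  forall z, lt_by P (z ^+ 2) (d ^+ 2) -> Q (1 - z ^+ 2).
have mono (P Q : F -> Prop) (d d' : F) : Phi P Q d -> (forall P, ordering P -> P (d ^+ 2 - d' ^+ 2)) ->
  Phi P Q d'.
  move=> h le oP oQ z /(ltP_by oP) lz; apply: (h oP oQ); apply/(ltP_by oP).
  by apply: lt_le_trans lz _; apply/(leP_by oP); apply: le.
have PhiP (P : F -> Prop) : exists2 d, hull_unit d & forall Q, List.In Q l -> Phi P Q d.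
  apply: (common_small oP1) => [Q d d'|Q _]; first exact: mono.
  have [[oP oQ]|n] := boolp.pselect (ordering P /\ ordering Q).
    by have [d hd dP] := deps P Q oP oQ; exists d => // _ _; exact: dP.
  by exists 1; [exact: hull_unit1 | move=> oP oQ; case: n].
pose Psi (P : F -> Prop) (d : F) := ordering P -> infinitesimal P d /\
  forall Q, List.In Q l -> Phi P Q d.
have mono' (P : F -> Prop) (d d' : F) : (forall P, ordering P -> P (d ^+ 2 - d' ^+ 2)) ->
    ordering P -> infinitesimal P d -> infinitesimal P d'.
  move=> le oP h k; apply/(leP_by oP); apply: le_trans (_ : (k%:R * d ^+ 2 : ordered_by oP) <= _).
    by apply: ler_wpM2l; [exact: (@ler0n (ordered_by oP)) | apply/(leP_by oP); apply: le].
  exact/(leP_by oP)/h.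
have [||d hd dP] := common_small (l := l) (Phi := Psi) oP1.
- move=> P d d' h le oP; have [h1 h2] := h oP; split; first exact: mono' le oP h1.
  by move=> Q lQ; apply: mono (h2 Q lQ) le.
- move=> P _; have [oP|n] := boolp.pselect (ordering P); last first.
    by exists 1; [exact: hull_unit1 | move=> oP; case: n].
  have [d hd dP] := PhiP P; have [t ht tP] := inf P oP.
  have le := fun Q => @shrinkM_le F d t Q.
  exists (shrink d * shrink t); first by apply: hull_unitM; apply: (shrink_unit oP).
  move=> _; split; first by apply: mono' tP => // Q oQ; case: (le Q oQ).
  by move=> Q lQ; apply: mono (dP Q lQ) _ => Q' oQ'; case: (le Q' oQ').
exists d; split=> // [P oP|P Q z oP oQ].
  by case: (dP P (lP P oP) oP).
by case: (dP P (lP P oP) oP) => _ h; apply: h => //; exact: lP.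
Qed.

(** With [w] the larger of [z^2], [z'^2] and [m = n n'], one has [w^m < d^2] and
    [(z - z')^2 <= 4 w]. Doubling the exponent leaves a spare factor [w^m], which absorbs [(4^m)^2]
    because [d] is infinitesimal. *)
Lemma prime_hull_sub (R : realFieldType) (d z z' : R) (n n' : nat) :
  (forall k, k%:R * d ^+ 2 <= 1) -> (0 < n)%N -> (0 < n')%N ->
  (z ^+ n) ^+ 2 < d ^+ 2 -> (z' ^+ n') ^+ 2 < d ^+ 2 ->
  ((z - z') ^+ (2 * (n * n'))) ^+ 2 < d ^+ 2.
Proof.
move=> inf n0 n'0 hz hz'; set m := (n * n')%N.
have d1 := infinitesimal_lt1 inf.
have dz : 0 < d ^+ 2 by apply: le_lt_trans hz; exact: sqr_ge0.
have pow (y : R) (a b : nat) : (0 < b)%N -> (y ^+ a) ^+ 2 < d ^+ 2 ->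
    (y ^+ 2) ^+ (a * b) < d ^+ 2.
  move=> b0 h; rewrite exprM [(y ^+ 2) ^+ a]exprAC.
  apply: lt_le_trans (_ : (d ^+ 2) ^+ b <= _).
    by rewrite ltrXn2r ?sqr_ge0 // -lt0n.
  by rewrite ler_iXnr ?sqr_ge0 // ltW.
have hm : (z ^+ 2) ^+ m < d ^+ 2 by apply: pow.
have hm' : (z' ^+ 2) ^+ m < d ^+ 2 by rewrite /m mulnC; apply: pow.
have [w [w0 hw hzw]] : exists w, [/\ 0 <= w, w ^+ m < d ^+ 2 & (z - z') ^+ 2 <= 4 * w].
  have [le|/ltW le] := lerP (z ^+ 2) (z' ^+ 2).
    by exists (z' ^+ 2); split; rewrite ?sqr_ge0 //; nra.
  by exists (z ^+ 2); split; rewrite ?sqr_ge0 //; nra.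
have -> : ((z - z') ^+ (2 * m)) ^+ 2 = (((z - z') ^+ 2) ^+ m) ^+ 2 by rewrite -!exprM !mulnA.
have w4 : 0 <= 4 * w by rewrite mulr_ge0.
apply: le_lt_trans (_ : ((4 * w) ^+ m) ^+ 2 < _).
  apply: lerXn2r; rewrite ?nnegrE; [| exact: exprn_ge0 |].
    by apply: exprn_ge0; exact: sqr_ge0.
  by apply: lerXn2r; rewrite ?nnegrE ?sqr_ge0.
rewrite exprMn exprMn; have w20 : 0 <= w ^+ m by exact: exprn_ge0.
have : (4 ^+ m) ^+ 2 * d ^+ 2 <= 1 by rewrite -natrX -natrX.
move: ((4 ^+ m) ^+ 2) (exprn_ge0 2 (exprn_ge0 m (ler0n R 4))) => K K0 hK.
move: (w ^+ m) w20 (d ^+ 2) dz hw hK => x x0 D D0 hx hK.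
have h1 : K * x <= 1 by apply: le_trans hK; apply: ler_wpM2l => //; exact: ltW.
by apply: le_lt_trans hx; rewrite expr2 mulrA ler_piMl.
Qed.

Definition prime_hull (F : fieldType) (P : F -> Prop) (d z : F) : Prop :=
  exists2 n, (0 < n)%N & lt_by P ((z ^+ n) ^+ 2) (d ^+ 2).

Lemma prime_hull_cube (R : realFieldType) (d z : R) (n : nat) :
  0 < d ^+ 2 -> (z ^+ n) ^+ 2 < d ^+ 2 -> (z ^+ (3 * n) / d ^+ 2) ^+ 2 < d ^+ 2.
Proof.
move=> d0 lz; rewrite expr_div_n ltr_pdivrMr; last by rewrite exprn_gt0.
have -> : (z ^+ (3 * n)) ^+ 2 = ((z ^+ n) ^+ 2) ^+ 3.
  by rewrite -!exprM !mulnA [(3 * n)%N]mulnC mulnAC.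
by rewrite -exprS ltrXn2r // sqr_ge0.
Qed.

(** If [|z^n| < |d|] at [P], then [z^(3 n) / d^2] is still below [d] there, so it is at most 1 at
    [Q], and [|z^(3 n)| <= d^2 < |d|] at [Q]. *)
Lemma prime_hull_switch (F : fieldType) (P Q : F -> Prop) (d z : F) :
  ordering P -> ordering Q -> d != 0 -> infinitesimal P d -> infinitesimal Q d ->
  (forall z, lt_by P (z ^+ 2) (d ^+ 2) -> Q (1 - z ^+ 2)) ->
  prime_hull P d z -> prime_hull Q d z.
Proof.
move=> oP oQ d0 iP iQ dPQ [n n0 /(ltP_by oP) lz]; exists (3 * n)%N; first by rewrite muln_gt0.
have dpos (o : F -> Prop) (oo : ordering o) : (0 : ordered_by oo) < d ^+ 2.
  by rewrite lt0r sqrf_eq0 [X in ~~ X](negbTE d0) /= (@sqr_ge0 (ordered_by oo)).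
have lt : lt_by P ((z ^+ (3 * n) / d ^+ 2) ^+ 2) (d ^+ 2).
  by apply/(ltP_by oP); exact: prime_hull_cube (dpos _ oP) lz.
have /(leP_by oQ) := dPQ _ lt; rewrite expr_div_n ler_pdivrMr; last first.
  by apply: (@exprn_gt0 (ordered_by oQ)); exact: dpos.
rewrite mul1r => le; apply/(ltP_by oQ); apply: le_lt_trans le _.
rewrite expr2 (@gtr_pMl (ordered_by oQ)); last exact: dpos.
by apply: infinitesimal_lt1 => k; exact/(leP_by oQ)/iQ.
Qed.

(* The radical of [d] is an ideal [M] of the hull not depending on the ordering.  The
   ring [{x | x M <= M}] is convex for every ordering, so it contains the hull, and
   [d^-1] in it gives [1] in [M], although [d] is infinitesimal. *)
Lemma dep_ordering_unique (F : fieldType) (l : seq (F -> Prop)) (P1 P2 : F -> Prop) :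
  (forall Q : F -> Prop, ordering Q -> List.In Q l) ->
  (forall x : F, x != 0 -> unit_class x) ->
  (forall P Q : F -> Prop, ordering P -> ordering Q -> dep P Q) ->
  ordering P1 -> ordering P2 -> P1 = P2.
Proof.
move=> lP all deps oP1 oP2; apply: boolp.contrapT => nP12.
have [d [[d0 hd hdV] inf dPQ]] := common_scale lP all oP1 oP2 nP12 deps.
have switch P Q z : ordering P -> ordering Q -> prime_hull P d z -> prime_hull Q d z.
  move=> oP oQ; apply: prime_hull_switch => //; try exact: inf.
  by move=> y; apply: dPQ.
pose B x := forall z, prime_hull P1 d z -> prime_hull P1 d (x * z).
have cB : all_convex B.
  split.
  - by move=> z; rewrite mul1r.
  - move=> x y Bx By z Mz; have [n n0 /(ltP_by oP1) hn] := Bx z Mz.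
    have [m m0 /(ltP_by oP1) hm] := By z Mz.
    exists (2 * (n * m))%N; first by rewrite !muln_gt0 n0 m0.
    apply/(ltP_by oP1); rewrite mulrBl.
    exact: prime_hull_sub (fun k => (leP_by oP1 _ _).1 (inf P1 oP1 k)) n0 m0 hn hm.
  - by move=> x y Bx By z Mz; rewrite -mulrA; apply: Bx; apply: By.
  (* Convexity for [Q] is checked in [Q] itself, after moving the radical from [P1] to [Q], and the
     result is moved back. *)
  - move=> Q x oQ /(leP_by oQ) x1 z /(switch P1 Q z oP1 oQ) [n n0 /(ltP_by oQ) hn].
    apply: (switch Q P1) => //; exists n => //; apply/(ltP_by oQ).
    apply: le_lt_trans hn; rewrite !exprMn; apply: ler_piMl.
      exact: (@sqr_ge0 (ordered_by oQ)).
    rewrite exprAC; apply: (@exprn_ile1 (ordered_by oQ)) => //.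
    exact: (@sqr_ge0 (ordered_by oQ)).
have d1 : (d ^+ 2 : ordered_by oP1) < 1.
  by apply: infinitesimal_lt1 => k; exact/(leP_by oP1)/(inf P1 oP1 k).
have Md : prime_hull P1 d d.
  exists 2 => //; apply/(ltP_by oP1); rewrite [X in X < _]expr2 gtr_pMl //.
  by rewrite lt0r sqrf_eq0 [X in ~~ X](negbTE d0) /= (@sqr_ge0 (ordered_by oP1)).
have [n n0] := hdV B cB d Md; rewrite mulVf // !expr1n => /(ltP_by oP1) lt.
by have := lt_trans lt d1; rewrite ltxx.
Qed.

(** * The character that permutes the orderings *)

Theorem connected_translation (F : fieldType) :
  pythagorean F -> formally_real F -> finitely_many_orderings F ->
  XF_connected F -> ~ rank_is (@XF F) 1 ->
  exists M : F -> Prop, [/\ index2 M, exists2 a, a != 0 & ~ M a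
    & forall P, ordering P -> ordering (fun x => x = 0 \/ (x != 0 /\ (P x <-> M x)))].
Proof.
move=> pyth fr [l lP] conn rk; have [P0 oP0] := formally_real_ordering pyth fr.
have {}lP (Q : F -> Prop) : ordering Q -> List.In Q l.
  move=> oQ; have [R lR e] := lP Q oQ; rewrite (_ : Q = R) //.
  by apply: boolp.funext => x; apply: boolp.propext.
have [all|nall] := boolp.pselect (forall x : F, x != 0 -> unit_class x).
  (* If [H = F^*], then [P0] is the only ordering and its signature alone is a basis, so the rank is
     1. *)
  case: rk; have uniq (P : F -> Prop) : ordering P -> P = P0.
    move=> oP; apply: (dep_ordering_unique lP all) => // P' Q' oP' oQ'.
    exact: connected_dep lP all conn oP' oQ'.
  exists [:: sgn P0]; split=> //.
  - move=> g [<-|//]; exists [:: sgn P0]; split.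
      by move=> h [<-|//]; exists P0.
    move=> a a0 /=; rewrite /chr_mul /chr_one; have := boolp.EM (sgn P0 a); tauto.
  - move=> [|b [|]] // _ /=; case: b => /= [e|_] [|[|i]] //.
    have N1 : (-1 : F) != 0 by rewrite oppr_eq0 oner_neq0.
    have := e _ N1; have : sgn P0 (-1) := ordering_N1 oP0.
    by rewrite /chr_mul /chr_one; tauto.
  - move=> f [P oP e]; exists [:: sgn P0]; split; first by move=> h [<-|//]; left.
    move=> a a0 /=; rewrite e // (uniq P oP) /chr_mul /chr_one.
    have := boolp.EM (sgn P0 a); tauto.
have [a [a0 nHa]] : exists a : F, a != 0 /\ ~ unit_class a.
  apply: boolp.contrapT => na; apply: nall => x x0; apply: boolp.contrapT => nHx.
  by apply: na; exists x.
have Hn0 (x : F) : unit_class x -> x != 0.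
  by move=> [u [s [[u0 _ _] s0 ->]]]; rewrite mulf_neq0 // expf_neq0.
have [M [sHM nMa Mn0 MM MMN]] :=
  maximal_subgroup Hn0 (@unit_classM F) (@unit_class_sqr F) a0 nHa.
have iM : index2 M.
  split=> // [s s0|]; first by apply: sHM; apply: unit_class_sqr.
  apply: sHM; exists (-1), 1; rewrite oner_neq0 expr1n mulr1; split=> //.
  by apply: hull_unitN; exact: hull_unit1.
exists M; split=> //; first by exists a.
move=> P oP; apply: rigid_translate => // b b0 nMb.
apply: not_unit_class_rigid => // Hb; apply: nMb; exact: sHM.
Qed.

(** * Kummer theory of square roots *)

Section Quadratic.

Variables (F : fieldType) (L : splittingFieldType F).
Implicit Types (E K : {subfield L}) (x y z r : L).

Lemma sqr_eq x y : x ^+ 2 = y ^+ 2 -> x = y \/ x = - y.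
Proof. by move/eqP; rewrite eqf_sqr => /orP[] /eqP; [left|right]. Qed.

Lemma sqrt_neq0 r (b : F) : b != 0 -> r ^+ 2 = b%:A -> r != 0.
Proof.
by move=> b0 er; rewrite -sqrf_eq0 er scaler_eq0 oner_eq0 orbF.
Qed.

Lemma ahom_alg (f : 'AEnd(L)) (b : F) : f b%:A = b%:A.
Proof. by rewrite linearZ /= rmorph1. Qed.

Lemma ahomM (f : 'AEnd(L)) x y : f (x * y) = f x * f y.
Proof. exact: rmorphM. Qed.

Lemma ahomN (f : 'AEnd(L)) x : f (- x) = - f x.
Proof. exact: raddfN. Qed.

Lemma ahom_sqr (f : 'AEnd(L)) x : f (x ^+ 2) = f x ^+ 2.
Proof. exact: rmorphXn. Qed.

Lemma mem_quadratic_adjoin K x y : y ^+ 2 \in K -> x \in <<K; y>>%VS ->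
  exists u v, [/\ u \in K, v \in K & x = u + v * y].
Proof.
move=> Ky /Fadjoin_polyP[p /polyOverP Kp ->]; rewrite horner_coef.
apply: (big_ind (fun w => exists u v, [/\ u \in K, v \in K & w = u + v * y]))
  => [|a b [u [v [Ku Kv ->]]] [u' [v' [Ku' Kv' ->]]]|j _].
- by exists 0, 0; rewrite mem0v mul0r addr0.
- by exists (u + u'), (v + v'); rewrite !memvD //; split=> //; ring.
have Kj : p`_j * (y ^+ 2) ^+ j./2 \in K by rewrite memvM // rpredX.
have -> : p`_j * y ^+ j = p`_j * (y ^+ 2) ^+ j./2 * y ^+ odd j.
  by rewrite -mulrA -exprM -exprD mul2n addnC odd_double_half.
case: (odd j); [exists 0, (p`_j * (y ^+ 2) ^+ j./2) | exists (p`_j * (y ^+ 2) ^+ j./2), 0];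
  by rewrite mem0v Kj ?expr1 ?expr0; split=> //; ring.
Qed.

(** Write [x = u + v y]. As [x^2] is in [K], so is [2 u v y]; hence [y] is in [K] or one of [u], [v]
    vanishes. *)
Lemma kummer_step K x y : char0 F ->
  x ^+ 2 \in K -> y ^+ 2 \in K -> x \in <<K; y>>%VS -> x \in K \/ x * y \in K.
Proof.
move=> ch Kx Ky /(mem_quadratic_adjoin Ky)[u [v [Ku Kv ex]]].
have two0 : 2%:R != 0 :> L.
  apply/negP => e; have := ch 2; rewrite -(pchar_lalg L).
  by rewrite inE /= e.
have [Kyy|nKy] := boolP (y \in K); first by left; rewrite ex memvD // memvM.
have uv0 : u * v = 0.
  apply/eqP; apply: contraNT nKy => uv0.
  have -> : y = (x ^+ 2 - u ^+ 2 - v ^+ 2 * y ^+ 2) / (2%:R * (u * v)).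
    have /norP[u0 v0] : ~~ ((u == 0) || (v == 0)) by rewrite -mulf_eq0.
    by rewrite ex; field; rewrite ?two0 ?u0 ?v0.
  have K2 : 2%:R \in K by rewrite rpredMn // mem1v.
  apply: memvM; last by rewrite memvV !memvM.
  have Ksq w : w \in K -> w ^+ 2 \in K by exact: rpredX.
  apply: memvB; first by apply: memvB => //; exact: Ksq.
  by apply: memvM => //; exact: Ksq.
have /eqP := uv0; rewrite mulf_eq0 => /orP[] /eqP e.
  by right; rewrite ex e add0r -mulrA -expr2 memvM.
by left; rewrite ex e mul0r addr0.
Qed.

(** Removing the last root [r], with [r^2 = h], leaves [x] or [x r] in the smaller field. This
    replaces [a] by [a h] at worst, which is harmless as [h] is in [M]. *)
Lemma kummer_adjoin (M : F -> Prop) (rs : seq L) x (a : F) : char0 F -> index2 M ->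
  (forall r, r \in rs -> exists2 h, M h & r ^+ 2 = h%:A) ->
  a != 0 -> x ^+ 2 = a%:A -> x \in <<1 & rs>>%VS -> M a.
Proof.
move=> ch iM; elim/last_ind: rs x a => [|rs r IH] x a hrs a0 ex.
  rewrite adjoin_nil subfield_closed => /vlineP[b eb].
  have : a%:A = (b ^+ 2)%:A :> L by rewrite -ex eb exprZn expr1n.
  move/(fmorph_inj (in_alg L)) => eab; rewrite eab; apply: index2_sqr => //.
  by apply: contraNneq a0 => b0; rewrite eab b0 expr0n.
rewrite adjoin_rcons => xr.
have [h Mh er] := hrs r (ltac:(by rewrite mem_rcons mem_head)).
have {}hrs r' : r' \in rs -> exists2 h, M h & r' ^+ 2 = h%:A.
  by move=> rr'; apply: hrs; rewrite mem_rcons in_cons rr' orbT.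
have alg1 (b : F) : b%:A \in <<1 & rs>>%AS by rewrite rpredZ // mem1v.
have e1 : x ^+ 2 \in <<1 & rs>>%AS by rewrite ex.
have e2 : r ^+ 2 \in <<1 & rs>>%AS by rewrite er.
have [xK|xrK] := kummer_step ch e1 e2 xr; first exact: IH hrs a0 ex xK.
have h0 := index2_neq0 iM Mh.
have : M (a * h).
  apply: (IH (x * r)) => //; first by rewrite mulf_neq0.
  by rewrite exprMn ex er -scalerAl mul1r scalerA.
by rewrite (index2_mulP iM) // => -[_]; apply.
Qed.

(** Each missing root raises the dimension, which that of [L] bounds. *)
Lemma adjoin_sqrts (M : F -> Prop) : exists rs : seq L,
  (forall r, r \in rs -> exists2 h, M h & r ^+ 2 = h%:A) /\
  (forall r h, M h -> r ^+ 2 = h%:A -> r \in <<1 & rs>>%VS).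
Proof.
have [n] := ubnP (\dim {:L} - \dim <<1 & [::] : seq L>>%VS)%N.
have : forall r, r \in [::] -> exists2 h, M h & r ^+ 2 = h%:A by [].
move: [::]; elim: n => // n IH rs hrs ltn.
have [h|] := boolp.pselect (forall r h, M h -> r ^+ 2 = h%:A -> r \in <<1 & rs>>%VS).
  by exists rs.
move=> /boolp.existsNP[r /boolp.existsNP[h /boolp.not_implyP[Mh /boolp.not_implyP[er /negP nr]]]].
apply: (IH (rcons rs r)) => [r'|].
  by rewrite mem_rcons in_cons => /predU1P[->|]; [exists h | exact: hrs].
have lt : (\dim <<1 & rs>> < \dim <<1 & rcons rs r>>)%N.
  rewrite adjoin_rcons ltnNge; apply: contra nr => le.
  have /eqP -> : (<<1 & rs>> == <<<<1 & rs>>; r>>)%VS by rewrite eqEdim subv_adjoin.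
  exact: memv_adjoin.
rewrite -ltnS; apply: leq_trans ltn; rewrite ltnS; apply: ltn_sub2l => //; apply: leq_trans lt _.
exact/dimvS/subvf.
Qed.

Lemma galois_full : char0 F -> galois 1 {:L}.
Proof.
move=> ch; rewrite /galois sub1v normalFieldf andbT; apply/separableP => x _.
by apply: pcharf0_separable => n; rewrite -(ch n) pchar_lalg.
Qed.

(** Let [N] be [F] with all square roots of elements of [M] adjoined. By Kummer theory [z] is not in
    [N], so some [tau] fixing [N] negates [z]. For [b] outside [M], [a b] is in [M], so [z r] is
    fixed and [r] is negated. *)
Lemma galois_character (M : F -> Prop) E (a : F) (z : L) :
  char0 F -> index2 M -> galois 1 E -> (forall r (b : F), r ^+ 2 = b%:A -> r \in E) ->
  a != 0 -> ~ M a -> z ^+ 2 = a%:A ->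
  exists2 tau, tau \in 'Gal(E / 1)%g & forall (b : F) r, b != 0 -> r ^+ 2 = b%:A ->
    (M b -> tau r = r) /\ (~ M b -> tau r = - r).
Proof.
move=> ch iM galE sE a0 nMa ez; have [rs [hrs allrs]] := adjoin_sqrts M.
pose N := <<1 & rs>>%AS.
have sNE : (N <= E)%VS.
  apply/Fadjoin_seqP; split; first exact: sub1v.
  by move=> r /hrs[h _ er]; exact: sE er.
have galN : galois N E by apply: galoisS galE; rewrite sub1v.
have nNz : z \notin N.
  by apply/negP => Nz; apply: nMa; exact: kummer_adjoin ch iM hrs a0 ez Nz.
have [tau tauN tz] : exists2 tau, tau \in 'Gal(E / N)%g & tau z != z.
  apply: boolp.contrapT => nt; move/negP: nNz; apply.
  rewrite -(galois_fixedField galN); apply/fixedFieldP; first exact: sE ez.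
  move=> tau tauN; apply/eqP/negPn/negP => tz; apply: nt; by exists tau.
have fixN r : r \in N -> tau r = r by apply: fixed_gal sNE tauN.
have {}tz : tau z = - z.
  have [e|//] : tau z = z \/ tau z = - z.
    by apply: sqr_eq; rewrite -ahom_sqr ez fixN // rpredZ // mem1v.
  by rewrite e eqxx in tz.
exists tau; first by apply: subsetP tauN; apply: galS; exact: sub1v.
move=> b r b0 er; split=> [Mb|nMb]; first by apply: fixN; exact: allrs Mb er.
have Nzr : z * r \in N.
  apply: (allrs _ (a * b)); first exact: index2MN.
  by rewrite exprMn ez er -scalerAl mul1r scalerA.
have z0 : z != 0 by exact: sqrt_neq0 a0 ez.
have := fixN _ Nzr; rewrite ahomM tz => e.
by apply: (mulfI z0); rewrite mulrN -e mulNr opprK.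
Qed.

(** * Stability of [F^(2)] and [F^(3)], and a fourth root outside [F^(2)] *)

Lemma normal_of_stable E : (forall f : 'AEnd(L), (f @: E <= E)%VS) -> normalField 1 E.
Proof.
move=> st; apply/forall_inP => f _; have := st f.
by rewrite -kAut1E => /andP[].
Qed.

(** Embeddings preserve dimension. The minimality clauses of [is_F2] and [is_F3] yield inclusions of
    the form [E <= f @: E]. *)
Lemma minimal_stable E (f : 'AEnd(L)) : (E <= f @: E)%VS -> (f @: E <= E)%VS.
Proof.
move=> le; have /eqP <- // : E == (f @: E)%VS :> {vspace L}.
by rewrite eqEdim le (kHom_dim (k1AHom E f)) leqnn.
Qed.

Lemma sqrt_mem (E2 : {subfield L}) (b : F) r : is_F2 E2 -> r ^+ 2 = b%:A -> r \in E2.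
Proof. by case=> sE _ er; apply: sE; rewrite er rpredZ // mem1v. Qed.

Lemma F2_stable (E2 : {subfield L}) (f : 'AEnd(L)) : is_F2 E2 -> (f @: E2 <= E2)%VS.
Proof.
move=> F2; apply: minimal_stable; have [_] := F2; apply => r /vlineP[b er].
have sr : r \in E2 := sqrt_mem F2 er.
have [e|e] : f r = r \/ f r = - r by apply: sqr_eq; rewrite -ahom_sqr er ahom_alg.
  by rewrite -e memv_img.
by rewrite -[r]opprK -e -ahomN memv_img // memvN.
Qed.

Lemma F3_galois (E2 E3 : {subfield L}) : char0 F -> is_F3 E2 E3 -> galois 1 E3.
Proof.
move=> ch [sK min]; have /and3P[_ sep _] := galois_full ch.
rewrite /galois sub1v (separableSr (subvf E3) sep) /=.
apply: normal_of_stable => f; apply: minimal_stable; apply: (min (aimg_aspace f E3)) => K gK.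
have [_ [_ /and3P[_ _ /forall_inP nK]]] := gK.
have := nK f; rewrite inE kAutfE k1AHom => /(_ isT) /eqP <-.
by apply: limgS; apply: sK.
Qed.

(* The Galois group of [F^(2)/F] has exponent 2, whereas an automorphism fixing [i]
   and negating [z] maps [y] to [i y] up to sign, so that its square negates [y]. *)
Lemma fourth_root_notin (M : F -> Prop) (E2 : {subfield L}) (i y z : L) (a : F) :
  char0 F -> index2 M -> is_F2 E2 -> a != 0 -> ~ M a ->
  i ^+ 2 = -1 -> z ^+ 2 = a%:A -> y ^+ 2 = z -> y \notin E2.
Proof.
move=> ch iM F2 a0 nMa ei ez ey.
have [s _ hs] := galois_character ch iM (galois_full ch) (fun r b _ => memvf r) a0 nMa ez.
have N10 : -1 != 0 :> F by rewrite oppr_eq0 oner_eq0.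
have eiN : i ^+ 2 = (-1)%:A by rewrite ei scaleN1r.
have si : s i = i by apply: (hs _ _ N10 eiN).1; exact: index2_N1.
have sz : s z = - z by apply: (hs _ _ a0 ez).2.
have ssy : s (s y) = - y.
  have [e|e] : s y = i * y \/ s y = - (i * y).
  - by apply: sqr_eq; rewrite -ahom_sqr ey sz exprMn ei ey mulN1r.
  - by rewrite e ahomM si e mulrA -expr2 ei mulN1r.
  - by rewrite e ahomN ahomM si e mulrN opprK mulrA -expr2 ei mulN1r.
pose ss : gal_of {:L} := (s * s)%g.
have sE2 : (E2 <= fixedField [set ss])%VS.
  case: F2 => _; apply => r /vlineP[b er]; apply/fixedFieldP; first exact: memvf.
  move=> _ /set1P ->; rewrite galM ?memvf //.
  have [b0|b0] := eqVneq b 0.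
    suff -> : r = 0 by rewrite !rmorph0.
    by apply/eqP; rewrite -sqrf_eq0 er b0 scale0r.
  have [h1 h2] := hs b r b0 er.
  have [/h1 e|/h2 e] := boolp.pselect (M b); first by rewrite !e.
  by rewrite e ahomN e opprK.
apply/negP => /(subvP sE2) /(fixedFieldP (memvf y)) /(_ ss (set11 _)).
rewrite galM ?memvf // ssy => e.
have y0 : y != 0 by rewrite -sqrf_eq0 ey (sqrt_neq0 a0 ez).
have two0 : 2%:R != 0 :> L by apply/negP => t; have := ch 2; rewrite -(pchar_lalg L) inE /= t.
have /eqP : 2%:R * y = 0 by rewrite mulr_natl mulr2n -{1}e addNr.
by rewrite mulf_eq0 (negbTE two0) (negbTE y0).
Qed.

(** An automorphism sends [z] to [z] or [- z], hence [y] to [y] or [i y] up to sign; these stay in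
    [E2(y)] since [i] is in [E2]. *)
Lemma good_quad_fourth_root (E2 : {subfield L}) (i y z : L) (a : F) :
  char0 F -> is_F2 E2 -> i ^+ 2 = -1 -> z ^+ 2 = a%:A -> y ^+ 2 = z -> y \notin E2 ->
  good_quad E2 <<E2; y>>%AS.
Proof.
move=> ch F2 ei ez ey nE2y.
have E2z : z \in E2 := sqrt_mem F2 ez.
have E2i : i \in E2 by apply: (@sqrt_mem _ (-1)); rewrite ?scaleN1r.
split; first exact: subv_adjoin.
split.
  rewrite dim_Fadjoin; congr (_ * _)%N.
  apply/eqP; rewrite eqn_leq; apply/andP; split; last first.
    by rewrite ltn_neqAle eq_sym adjoin_deg_eq1 nE2y.
  have p : ('X^2 - z%:P) \is a polyOver E2.
    by rewrite rpredB ?rpredX ?polyOverX ?polyOverC.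
  have rp : root ('X^2 - z%:P) y by rewrite rootE !hornerE ey subrr.
  have := dvdp_leq _ (minPoly_dvdp p rp).
  rewrite size_minPoly size_XnsubC // ltnS; apply.
  by rewrite -size_poly_gt0 size_XnsubC.
have /and3P[_ sep _] := galois_full ch.
rewrite /galois sub1v (separableSr (subvf _) sep) /=.
apply: normal_of_stable => f; rewrite /= aimg_adjoin.
apply/FadjoinP; split; first exact: subv_trans (F2_stable f F2) (subv_adjoin _ _).
have Ky : y \in <<E2; y>>%AS := memv_adjoin _ _.
have Ki : i \in <<E2; y>>%AS by apply: subvP (subv_adjoin _ _) _ E2i.
have [e|e] : f z = z \/ f z = - z by apply: sqr_eq; rewrite -ahom_sqr ez ahom_alg.
  have [->|->] : f y = y \/ f y = - y by apply: sqr_eq; rewrite -ahom_sqr ey e.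
    exact: Ky.
  by rewrite memvN; exact: Ky.
have [->|->] : f y = i * y \/ f y = - (i * y).
- by apply: sqr_eq; rewrite -ahom_sqr ey e exprMn ei ey mulN1r.
- exact: (memvM Ki Ky).
- by rewrite memvN; exact: (memvM Ki Ky).
Qed.

End Quadratic.

Unset Implicit Arguments.

(* L : a Galois extension of F large enough to contain F^(3): every element
   of E2 = F^(2) is a square in L.  i is a square root of -1 in L. *)
Theorem theorem3p6 (F : fieldType) (L : splittingFieldType F)
    (E2 E3 : {subfield L}) (i : L) :
  char0 F -> pythagorean F -> formally_real F -> finitely_many_orderings F ->
  XF_connected F -> ~ rank_is (@XF F) 1 ->
  is_F2 E2 -> (forall x : L, x \in E2 -> exists y : L, y ^+ 2 = x) ->
  is_F3 E2 E3 -> i ^+ 2 = -1 ->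
  exists2 tau : gal_of E3, (tau \in 'Gal(E3 / <<1; i>>%VS))%g &
    [/\ ~ chr_eq (chi tau) (@chr_one F),
        forall s, XF s -> XF (chr_mul (chi tau) s)
      & forall r, XF r -> exists2 s, XF s & chr_eq r (chr_mul (chi tau) s)].
Proof.
move=> ch pyth fr fin conn rk F2 sq F3 ei.
have [M [iM [a a0 nMa] tr]] := connected_translation pyth fr fin conn rk.
have sqF (b : F) : exists r : L, r ^+ 2 = b%:A by apply: sq; rewrite rpredZ // mem1v.
have [z ez] := sqF a.
have [y ey] := sq z (sqrt_mem F2 ez).
have nE2y := fourth_root_notin ch iM F2 a0 nMa ei ez ey.
have gK := good_quad_fourth_root ch F2 ei ez ey nE2y.
(* [is_F3] yields [E2 <= E3] only through an actual quadratic extension of [E2], here [E2(y)]. *)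
have sE23 : (E2 <= E3)%VS by apply: subv_trans (F3.1 _ gK); exact: subv_adjoin.
have galE3 := F3_galois ch F3.
have sE3 r (b : F) : r ^+ 2 = b%:A -> r \in E3.
  by move=> er; apply: subvP sE23 _ (sqrt_mem F2 er).
have [tau tau1 htau] := galois_character ch iM galE3 sE3 a0 nMa ez.
have N10 : -1 != 0 :> F by rewrite oppr_eq0 oner_eq0.
have eiN : i ^+ 2 = (-1)%:A by rewrite ei scaleN1r.
have E3i := sE3 _ _ eiN.
have ti : tau i = i by apply: (htau _ _ N10 eiN).1; exact: index2_N1.
have chiE (b : F) : b != 0 -> chi tau b <-> ~ M b.
  move=> b0; split=> [[r [er tr'] Mb]|nMb].
    have := (htau _ _ b0 er).1 Mb; rewrite tr' => e.
    have r0 := sqrt_neq0 b0 er.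
    have /eqP : 2%:R * r = 0 by rewrite mulr_natl mulr2n -{1}e addNr.
    rewrite mulf_eq0 (negbTE r0) orbF => t; have := ch 2.
    by rewrite -(pchar_lalg L) inE /= t.
  by have [r er] := sqF b; exists r; split=> //; apply: (htau _ _ b0 er).2.
have XFm s : XF s -> XF (chr_mul (chi tau) s).
  move=> [P oP e]; exists (fun x => x = 0 \/ (x != 0 /\ (P x <-> M x))); first exact: tr.
  move=> b b0; rewrite /chr_mul /sgn chiE // e // /sgn; have /eqP b0' := b0.
  have := boolp.EM (P b); have := boolp.EM (M b); tauto.
exists tau.
  have sK : (<<1; i>>%AS <= E3)%VS by apply/FadjoinP; split=> //; exact: sub1v.
  have : [set tau] \subset 'Gal(E3 / <<1; i>>%AS)%g.
    rewrite galois_connection //; apply/FadjoinP; split; first exact: sub1v.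
    by apply/fixedFieldP => // _ /set1P ->.
  by rewrite sub1set.
split=> [h| |r Xr]; first by have := (h a a0).1; rewrite chiE // => /(_ nMa).
  exact: XFm.
(* Multiplication by [chi tau] is its own inverse. *)
exists (chr_mul (chi tau) r); first exact: XFm.
move=> b b0; rewrite /chr_mul chiE //.
have := boolp.EM (r b); have := boolp.EM (M b); tauto.
Qed.
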